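(* Let $m\ge2$ and let $\mathcal{H}\in\mathcal{P}(\mathcal{H})$ be a connected linear ($m$-uniform) unicyclic hypergraph with $k$ edges whose cycle has length $l$, where $(k-l-5)(m-1)\ge12$. Suppose $\mathcal{H}\ne UC_l(c_1=k-l)$ and $\mathcal{H}\ne UC_l(c_1=k-l-1,c_2=1)$. Then $\lambda_1(\mathcal{H})\le\lambda_1(U_lC(c_1=k-l-1))$, and equality holds only when $\mathcal{H}=U_lC(c_1=k-l-1)$.
   Context: A hypergraph has a finite vertex set and an edge set of non-empty subsets of the vertex set; it is $m$-uniform if all edges have cardinality $m$, and linear if two distinct edges share at most one vertex. The adjacency matrix of a linear $m$-uniform hypergraph has $(i,j)$ entry $\frac{1}{m-1}$ if $i\ne j$ lie in a common edge, and $0$ otherwise; $\lambda_1$ denotes the spectral radius of this matrix. The $m$-th power hypergraph of a graph $G(V,E)$ is the $m$-uniform hypergraph obtained by adding to each edge $e\in E$ $m-2$ new vertices $v_{e,1},\dots,v_{e,m-2}$ (distinct for distinct edges). $\mathcal{P}(\mathcal{H})$ denotes the set of $m$-th power hypergraphs of graphs (a fixed notation for the set, not depending on the particular hypergraph $\mathcal{H}$). A loose cycle of length $l\ge3$, $C_L(l)=v_1e_1v_2e_2\dots v_le_lv_1$, is the $m$-uniform hypergraph with edges $e_1,\dots,e_l$ in which $e_{i-1}\cap e_i=\{v_i\}$ (indices mod $l$, the $v_i$ distinct) and non-consecutive edges are disjoint; $v_1,\dots,v_l$ are its core vertices. A linear hypergraph is unicyclic if it contains exactly one loose cycle. Attaching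 an edge at a vertex $v$ means adding a new edge consisting of $v$ and $m-1$ new vertices. $UC_l(c_1,\dots,c_l)$ is obtained from $C_L(l)$ by attaching $c_i$ (pendant) edges at $v_i$ for $i=1,\dots,l$; when only some of the $c_i$ are listed, the others are $0$. $U_lC(c_1=k-l-1)$ is the hypergraph with $k$ edges obtained from $UC_l(c_1=k-l-1)$ by attaching one more edge at a degree-one vertex of one of the $k-l-1$ pendant edges at $v_1$. Equality of hypergraphs means isomorphism. *)

(* Defs.v *)
From HB Require Import structures.
From mathcomp Require Import all_boot all_order all_algebra.

Set Implicit Arguments.
Unset Strict Implicit.
Unset Printing Implicit Defensive.

Import Order.TTheory GRing.Theory Num.Theory.
Local Open Scope ring_scope.

Record hypergraph := Hypergraph {
  vert :> finType;
  hedges : {set {set vert}};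
  hedges_nonempty : set0 \notin hedges
}.

Definition uniform (m : nat) (H : hypergraph) : Prop :=
  forall e, e \in hedges H -> #|e| = m.

Definition linear_hypergraph (H : hypergraph) : Prop :=
  forall e f, e \in hedges H -> f \in hedges H -> e != f -> (#|e :&: f| <= 1)%N.

Definition adjacent (H : hypergraph) (x y : H) : bool :=
  (x != y) && [exists e in hedges H, (x \in e) && (y \in e)].

Definition connected_hypergraph (H : hypergraph) : Prop :=
  forall x y : H, connect (@adjacent H) x y.

Definition hiso (H K : hypergraph) : Prop :=
  exists2 f : H -> K, bijective f
    & forall e : {set H}, (f @: e \in hedges K) = (e \in hedges H).

Definition adjmx (C : numClosedFieldType) (m : nat) (H : hypergraph) :
    'M[C]_#|H| :=
  \matrix_(i, j)
    if adjacent (enum_val i : H) (enum_val j) then (m - 1)%:R^-1 else 0.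

Definition eigenvalues (C : numClosedFieldType) (n : nat) (A : 'M[C]_n) :
    seq C :=
  sval (closed_field_poly_normal (char_poly A)).

(* Norms in a numClosedFieldType are nonnegative reals, hence pairwise
   comparable, so Num.max is a genuine maximum here. *)
Definition spectral_radius (C : numClosedFieldType) (n : nat) (A : 'M[C]_n) :
    C :=
  \big[Num.max/0]_(z <- eigenvalues A) `|z|.

Definition lambda1 (C : numClosedFieldType) (m : nat) (H : hypergraph) : C :=
  spectral_radius (adjmx C m H).

Section Power.
Variables (m : nat) (G : hypergraph).

Definition power_vert : finType :=
  (G + {e : {set G} | e \in hedges G} * 'I_(m - 2))%type.

Definition power_edge (e : {e : {set G} | e \in hedges G}) :
    {set power_vert} :=
  [set inl x | x in val e] :|: [set inr (e, t) | t : 'I_(m - 2)].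

Fact power_nonempty : set0 \notin [set power_edge e | e in predT].
Proof.
apply/imsetP => -[e _ /esym/eqP]; rewrite setU_eq0 imset_eq0 => /andP[/eqP e0 _].
by have := valP e; rewrite /= e0 (negPf (hedges_nonempty G)).
Qed.

Definition power : hypergraph := Hypergraph power_nonempty.

End Power.

(* A simple graph is a 2-uniform hypergraph. *)
Definition is_power (m : nat) (H : hypergraph) : Prop :=
  exists2 G : hypergraph, uniform 2 G & hiso H (power m G).

Definition loose_cycle (H : hypergraph) (l : nat)
    (v : 'I_l -> H) (e : 'I_l -> {set H}) : Prop :=
  [/\ (3 <= l)%N,
      injective v /\ injective e,
      forall i, e i \in hedges H,
      forall i, e (ord_pred i) :&: e i = [set v i]
    & forall i j, j != i -> j != ordS i -> j != ord_pred i ->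
        [disjoint e i & e j]].

(* A loose cycle is identified with its set of edges, so that rotations and
   reflections of the same closed sequence count once. *)
Definition cycle_of_length (H : hypergraph) (l : nat) (S : {set {set H}}) :
    Prop :=
  exists (v : 'I_l -> H) (e : 'I_l -> {set H}),
    loose_cycle v e /\ S = [set e i | i : 'I_l].

Definition unicyclic (H : hypergraph) : Prop :=
  exists! S : {set {set H}}, exists l : nat, cycle_of_length l S.

(* [CL m l]: the core vertices are the [inl i], the edge number [i] consists of
   the core vertices number [i] and [i + 1] (mod [l]) and of the [m - 2]
   vertices [inr (i, t)].  Meaningful for [3 <= l]. *)
Section LooseCycle.
Variables (m l : nat).

Definition CL_vert : finType := ('I_l + 'I_l * 'I_(m - 2))%type.

Definition CL_edge (i : 'I_l) : {set CL_vert} :=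
  [set inl i; inl (ordS i)] :|: [set inr (i, t) | t : 'I_(m - 2)].

Fact CL_nonempty : set0 \notin [set CL_edge i | i : 'I_l].
Proof. by apply/imsetP => -[i _ /setP/(_ (inl i))]; rewrite !inE eqxx. Qed.

Definition CL : hypergraph := Hypergraph CL_nonempty.

End LooseCycle.

(* One new edge, with [m - 1] new vertices, is attached at [f i] for each
   [i : I]. *)
Section Attach.
Variables (m : nat) (H : hypergraph) (I : finType) (f : I -> H).

Definition attach_vert : finType := (H + I * 'I_(m - 1))%type.

Definition attach_edge (i : I) : {set attach_vert} :=
  inl (f i) |: [set inr (i, t) | t : 'I_(m - 1)].

Definition attach_edges : {set {set attach_vert}} :=
  [set [set inl x | x in (e : {set H})] | e in hedges H]
    :|: [set attach_edge i | i : I].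

Fact attach_nonempty : set0 \notin attach_edges.
Proof.
rewrite inE negb_or; apply/andP; split; apply/imsetP => -[e].
  move=> He /esym/eqP; rewrite imset_eq0 => /eqP e0.
  by move: (hedges_nonempty H); rewrite -e0 He.
by move=> _ /setP/(_ (inl (f e))); rewrite !inE eqxx.
Qed.

Definition attach : hypergraph := Hypergraph attach_nonempty.

End Attach.

(* [UC m l [:: c_1; ...; c_r]] attaches [c_i] edges at the [i]-th core vertex;
   the [c_i] that are not listed are 0.  Core vertices are numbered from 0
   in 'I_l. *)
Definition UC_pendant (l : nat) (c : seq nat) : finType :=
  {i : 'I_l & 'I_(nth 0%N c i)}.

Definition UC (m l : nat) (c : seq nat) : hypergraph :=
  @attach m (CL m l) (UC_pendant l c) (fun p => inl (tag p)).

(* One more edge attached to [UC m l [:: c]], at the new vertex number [t] of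
   the pendant edge [p].  All these vertices have degree one, and all the
   pendant edges are at the first core vertex; the choice of [p] and [t]
   does not matter up to isomorphism. *)
Definition ULC (m l c : nat) (p : UC_pendant l [:: c]) (t : 'I_(m - 1)) :
    hypergraph :=
  @attach m (UC m l [:: c]) unit (fun=> inr (p, t)).

(* Main.v *)
From HB Require Import structures.
Require Import Defs.
From mathcomp Require Import all_boot all_order all_algebra.
From mathcomp Require Import perm ring lra zify.

(** The eigenvalue of U_lC is never computed; only the lower bound from its star is used. The
    parameter w is chosen for this: in a hyperstar whose leaves have weight 1 and whose centre has
    weight w, the leaf equation is mu = w + n - 1 and the centre equation is mu w = d n, d being the
    number of edges. The elimination rests on a vertex y private to an edge e: (mu + 1) x_y is the
    sum of x over e, so that sum is a fixed multiple of the sum over the two ends of e. Afterwards m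
    survives only through r, and the estimates must hold uniformly for r in [0, 1]; r = 0 is the
    case of graphs. If S off-cycle edges avoid the maximal vertex u, comparing its two-step
    expansion with the star bound leaves (S - 1) (1 + r w) on one side. For S = 1 this vanishes and
    nothing is contradicted, which is why the case of a single stray edge is settled by isomorphism
    or by moving that edge. *)

(* Put n = m - 1, let c = k - l be the number of edges off the cycle, and let
   x be the Perron vector of H for the largest eigenvalue mu = n * lambda_1 of
   its 0/1 adjacency matrix.  Eliminating the vertices added by the power
   construction gives, on the vertices of the underlying graph and with
   w = mu - n + 1 and r = (n - 1) / (w + n) in [0, 1],
     w x_v = r (deg v - 1) x_v + (sum of x over the neighbours of v).
   In U_lC some vertex has degree c + 1, and the Rayleigh quotient of the star
   around it shows lambda_1(U_lC) > lambda_1(H) unless (c + 1) n <= w (w + n - 1),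
   that is, w^2 >= r c w + c + 1.  In the remaining case (c - 5) n >= 12 yields
   w^2 >= 18 - 12 r + 5 r w, hence w > 4.  Apply the equation twice at a vertex
   u of maximal weight: the contribution of the 2-paths from u is too small
   unless u lies on the cycle and at most one edge off the cycle does not
   contain u.  That edge exists as H is not UC_l(c_1 = k - l).  If it is attached
   to a leaf then H = U_lC; if it is attached to a cycle vertex v, then v is not
   adjacent to u, its weight is smaller than that of the leaves around u, and
   moving the edge to such a leaf turns H into U_lC and increases lambda_1. *)

Set Implicit Arguments.
Unset Strict Implicit.
Unset Printing Implicit Defensive.

Import Order.TTheory GRing.Theory Num.Theory.

(** * Cyclic ordinals *)

Lemma val_ordS l (i : 'I_l) : ordS i = (if i.+1 == l then 0%N else i.+1) :> nat.
Proof.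
rewrite /=; case: eqP => [->|ne]; first by rewrite modnn.
by rewrite modn_small // ltn_neqAle ltn_ord andbT; apply/eqP.
Qed.

Lemma ordS_neq l (i : 'I_l) : (1 < l)%N -> ordS i != i.
Proof.
move=> l1; apply/eqP => /(congr1 (@nat_of_ord l)); rewrite val_ordS.
by case: eqP; lia.
Qed.

Lemma ordSS_neq l (i : 'I_l) : (2 < l)%N -> ordS (ordS i) != i.
Proof.
move=> l2; apply/eqP => /(congr1 (@nat_of_ord l)); rewrite !val_ordS.
by have := ltn_ord i; case: eqP; case: eqP; lia.
Qed.

Lemma ord_pred_neq l (i : 'I_l) : (1 < l)%N -> ord_pred i != i.
Proof. by move=> l1; rewrite -(inj_eq (@ordS_inj l)) ord_predK eq_sym ordS_neq. Qed.

Lemma ordS_ord_pred_neq l (i : 'I_l) : (2 < l)%N -> ordS i != ord_pred i.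
Proof. by move=> l2; rewrite -(inj_eq (@ordS_inj l)) ord_predK ordSS_neq. Qed.

Lemma iter_ordS l k (i : 'I_l) : iter k (@ordS l) i = (i + k) %% l :> nat.
Proof.
elim: k => [|k IHk]; first by rewrite addn0 modn_small.
by rewrite iterS /= IHk -[in LHS]addn1 modnDml addn1 addnS.
Qed.

Lemma iter_ordS_trans l (i j : 'I_l) : exists k, j = iter k (@ordS l) i.
Proof.
exists (j + (l - i)); apply: ord_inj; rewrite iter_ordS addnCA subnKC; last exact: ltnW.
by rewrite modnDr modn_small.
Qed.

Definition cycle_ends (l : nat) (i : 'I_l) : {set 'I_l} := [set i; ordS i].

Lemma cycle_ends_inj l : (2 < l)%N -> injective (@cycle_ends l).
Proof.
move=> l3 i j /setP ij.
have := ij i; rewrite !inE eqxx => /esym/orP[/eqP//|/eqP iE].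
have := ij j; rewrite !inE eqxx => /orP[/eqP//|/eqP jE].
by have := ordSS_neq i l3; rewrite -jE -iE eqxx.
Qed.

(* [sE] is the action on edges of the automorphism [s] of the cycle. *)
Definition cycle_auto l (s sE : 'I_l -> 'I_l) : Prop :=
  [/\ bijective s, bijective sE &
      forall e v, (s v \in cycle_ends (sE e)) = (v \in cycle_ends e)].

(** [UC] attaches c_1 and c_2 at the core vertices numbered 0 and 1, so a chosen vertex must be
    brought to 0 and its successor to 1. *)
Lemma cycle_rotation l (i0 : 'I_l) : (1 < l)%N -> exists s,
  [/\ cycle_auto s s, s i0 = 0 :> nat & s (ordS i0) = 1 :> nat].
Proof.
move=> l1; have l0 := ltnW l1; have [k kE] := iter_ordS_trans i0 (Ordinal l0).
have SC i : iter k (@ordS l) (ordS i) = ordS (iter k (@ordS l) i).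
  by rewrite -iterSr iterS.
have sI : injective (iter k (@ordS l)) by elim: (k) => //= j IHj a b /ordS_inj/IHj.
exists (iter k (@ordS l)); split; last 2 first.
- by rewrite -kE.
- by rewrite SC -kE val_ordS; case: eqP l1 => //= <-.
split; [exact: injF_bij|exact: injF_bij|move=> e v].
by rewrite !inE -SC !(inj_eq sI).
Qed.

(** The counterpart for the predecessor of [i0]. Reversal sends the edge from i to i + 1 to the edge
    that starts at the image of i + 1, hence the [ordS] in the edge map. *)
Lemma cycle_reflection l (i0 : 'I_l) : (1 < l)%N -> exists s sE,
  [/\ cycle_auto s sE, s i0 = 0 :> nat & s (ord_pred i0) = 1 :> nat].
Proof.
move=> l1; have revS i : ordS (rev_ord (@ordS l i)) = rev_ord i.
  apply: ord_inj; rewrite val_ordS /=; have := val_ordS i; rewrite /= => ->.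
  by have := ltn_ord i; case: (eqVneq i.+1 l) => iS; case: ifP; lia.
have [s [[sB _ sE] s0 s1]] := cycle_rotation (rev_ord i0) l1.
have rB : bijective (@rev_ord l) by exists (@rev_ord l); apply: rev_ordK.
have ordSB := @ordS_bij l.
exists (s \o @rev_ord l), (s \o @rev_ord l \o @ordS l); split=> //.
- split; [exact: bij_comp|exact: bij_comp (bij_comp sB rB) ordSB|move=> e v].
  rewrite /= sE !inE revS !(inj_eq rev_ord_inj) orbC.
  by [].
- by rewrite /= -(revS (ord_pred i0)) ord_predK.
Qed.

(** * Skeletons *)

(* [K] is obtained from the multigraph [(V, E, ends)] by completing each edge
   with vertices of its own into a set of cardinality [m]. *)
Record skeleton (m : nat) (V E : finType) (ends : E -> {set V})
    (K : hypergraph) (io : V -> K) (ph : E -> {set K}) : Prop := Skeleton {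
  sk_inj : injective io;
  sk_edges : hedges K = [set ph e | e : E];
  sk_card : forall e, #|ph e| = m;
  sk_ends : forall e v, (io v \in ph e) = (v \in ends e);
  sk_disj : forall e e' y,
    y \in ph e -> y \in ph e' -> e != e' -> y \in codom io;
  sk_cover : forall y, y \notin codom io -> exists e, y \in ph e
}.

Section SkeletonTransport.
Variables (m : nat) (V E : finType) (ends : E -> {set V}).

Definition own_vertices (K : hypergraph) (io : V -> K) (ph : E -> {set K}) e :=
  [set y in ph e | y \notin codom io].

Lemma card_own_vertices (K : hypergraph) (io : V -> K) ph e :
  skeleton m ends io ph -> #|own_vertices io ph e| = (m - #|ends e|)%N.
Proof.
move=> sk; rewrite -(sk_card sk e) -(card_imset _ (sk_inj sk)).
have -> : [set io v | v in ends e] = [set y in ph e | y \in codom io].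
  apply/setP => y; rewrite inE; apply/imsetP/andP => [[v ve ->]|[ye /codomP[v yE]]].
    by rewrite (sk_ends sk) ve codom_f.
  by exists v; rewrite // -(sk_ends sk) -yE.
rewrite -[#|ph e|](cardsID [set y | y \in codom io]) addnC.
have -> : ph e :&: [set y | y \in codom io] = [set y in ph e | y \in codom io].
  by apply/setP => y; rewrite !inE.
by rewrite addnK; apply: eq_card => y; rewrite !inE andbC.
Qed.

(** Vertices of [V] are matched through the embeddings, and the private vertices of an edge by their
    position in an enumeration; corresponding edges have equally many of them. The default [y0] is
    never reached between two skeletons. *)
Definition transport (K : hypergraph) (io : V -> K) (ph : E -> {set K})
    (K' : hypergraph) (io' : V -> K') (ph' : E -> {set K'}) (y0 : K') (y : K) : K' :=
  if [pick v | io v == y] is Some v then io' v else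
  if [pick e | y \in ph e] is Some e then
    nth y0 (enum (own_vertices io' ph' e)) (index y (enum (own_vertices io ph e)))
  else y0.

Section Transport.
Variables (K K' : hypergraph) (io : V -> K) (ph : E -> {set K}).
Variables (io' : V -> K') (ph' : E -> {set K'}) (y0 : K').
Hypotheses (sk : skeleton m ends io ph) (sk' : skeleton m ends io' ph').

Lemma transport_io v : transport io ph io' ph' y0 (io v) = io' v.
Proof.
rewrite /transport; case: pickP => [v' /eqP/(sk_inj sk)->//|/(_ v)].
by rewrite eqxx.
Qed.

Lemma transport_own e y : y \in own_vertices io ph e ->
  transport io ph io' ph' y0 y =
    nth y0 (enum (own_vertices io' ph' e)) (index y (enum (own_vertices io ph e)))
  /\ transport io ph io' ph' y0 y \in own_vertices io' ph' e.
Proof.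
rewrite inE => /andP[ye yio].
have tE : transport io ph io' ph' y0 y =
    nth y0 (enum (own_vertices io' ph' e)) (index y (enum (own_vertices io ph e))).
  rewrite /transport; case: pickP => [v /eqP yE|_].
    by rewrite -yE codom_f in yio.
  case: pickP => [e' ye'|/(_ e)]; last by rewrite ye.
  case: (eqVneq e' e) => [-> //|ne].
  by rewrite (sk_disj sk ye' ye ne) in yio.
split=> //; rewrite tE -mem_enum mem_nth // -cardE (card_own_vertices _ sk').
by rewrite -(card_own_vertices e sk) cardE index_mem mem_enum inE ye.
Qed.

Lemma transportK : forall z0,
  cancel (transport io ph io' ph' y0) (transport io' ph' io ph z0).
Proof.
move=> z0 y; case: (boolP (y \in codom io)) => [/codomP[v ->]|yio].
  rewrite transport_io /transport; case: pickP => [v' /eqP/(sk_inj sk')->//|/(_ v)].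
  by rewrite eqxx.
have [e ye] := sk_cover sk yio.
have yB : y \in own_vertices io ph e by rewrite inE ye.
have [tE] := transport_own yB; rewrite inE => /andP[te tio].
rewrite /transport -/(transport io ph io' ph' y0 y); case: pickP => [v /eqP tv|_].
  by rewrite -tv codom_f in tio.
case: pickP => [e' te'|/(_ e)]; last by rewrite te.
have -> : e' = e.
  by apply/eqP; apply: contraNT tio; apply: (sk_disj sk' te' te).
rewrite tE index_uniq ?enum_uniq ?nth_index ?mem_enum //.
rewrite -cardE (card_own_vertices _ sk') -(card_own_vertices e sk).
by rewrite cardE index_mem mem_enum.
Qed.

Lemma transport_edge e y : (transport io ph io' ph' y0 y \in ph' e) = (y \in ph e).
Proof.
have sub e' z : z \in ph e' -> transport io ph io' ph' y0 z \in ph' e'.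
  case: (boolP (z \in codom io)) => [/codomP[v ->]|zio ze].
    by rewrite transport_io (sk_ends sk) (sk_ends sk').
  have zB : z \in own_vertices io ph e' by rewrite inE ze.
  by have [_] := transport_own zB; rewrite inE => /andP[].
apply/idP/idP => [te|]; last exact: sub.
case: (boolP (y \in codom io)) te => [/codomP[v ->]|yio te].
  by rewrite transport_io (sk_ends sk) (sk_ends sk').
have [e' ye'] := sk_cover sk yio.
case: (eqVneq e e') => [->//|ne].
have yB : y \in own_vertices io ph e' by rewrite inE ye'.
have [_] := transport_own yB; rewrite inE => /andP[te' /negP[]].
exact: (sk_disj sk' te te' ne).
Qed.

End Transport.

(** The action on [io] is recorded because moving an edge compares Perron weights of particular
    vertices across the isomorphism. *)
Lemma skeleton_iso (K K' : hypergraph) (io : V -> K) ph (io' : V -> K') ph' :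
    K -> K' -> skeleton m ends io ph -> skeleton m ends io' ph' ->
  exists2 f : K -> K', bijective f /\
      (forall e : {set K}, (f @: e \in hedges K') = (e \in hedges K))
    & forall v, f (io v) = io' v.
Proof.
move=> z0 y0 sk sk'; pose f := transport io ph io' ph' y0.
have fK : cancel f (transport io' ph' io ph z0) by exact: transportK.
have Kf : cancel (transport io' ph' io ph z0) f by exact: transportK.
exists f; last by move=> v; apply: transport_io.
split; first by exists (transport io' ph' io ph z0).
have fph e : f @: ph e = ph' e.
  apply/setP => y; apply/imsetP/idP => [[z ze ->]|ye].
    by rewrite (transport_edge _ sk sk').
  exists (transport io' ph' io ph z0 y); last by rewrite Kf.
  by rewrite (transport_edge _ sk' sk).
move=> S; rewrite (sk_edges sk) (sk_edges sk').
apply/imsetP/imsetP => -[e _]; last by move=> ->; exists e.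
rewrite -fph => /(imset_inj (can_inj fK)) ->; by exists e.
Qed.

Lemma skeleton_relabel (V' E' : finType) (ends' : E' -> {set V'}) (hV : V' -> V) (hE : E' -> E)
    (K : hypergraph) (io : V -> K) ph :
    bijective hV -> bijective hE -> (forall e v, (hV v \in ends (hE e)) = (v \in ends' e)) ->
  skeleton m ends io ph -> skeleton m ends' (io \o hV) (ph \o hE).
Proof.
move=> bV [hE' hEK hKE] he sk; have [hV' hVK hKV] := bV.
have codE y : (y \in codom (io \o hV)) = (y \in codom io).
  apply/codomP/codomP => [[v ->]|[v ->]]; first by exists (hV v).
  by exists (hV' v); rewrite /= hKV.
split=> [|||e v|e e' y ye ye' ne|y].
- exact: inj_comp (sk_inj sk) (bij_inj bV).
- rewrite (sk_edges sk); apply/setP => S; apply/imsetP/imsetP => -[e _ ->].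
    by exists (hE' e); rewrite //= hKE.
  by exists (hE e).
- by move=> e; rewrite /= (sk_card sk).
- by rewrite /= (sk_ends sk) he.
- by rewrite codE; apply: (sk_disj sk ye ye'); rewrite (inj_eq (can_inj hEK)).
- rewrite codE => /(sk_cover sk)[e ye].
  by exists (hE' e); rewrite /= hKE.
Qed.

End SkeletonTransport.

Lemma skeleton_linear m (V E : finType) (ends : E -> {set V}) (K : hypergraph)
    (io : V -> K) ph :
    skeleton m ends io ph ->
    (forall e e', e != e' -> (#|ends e :&: ends e'| <= 1)%N) ->
  linear_hypergraph K.
Proof.
move=> sk lin S S'; rewrite (sk_edges sk) => /imsetP[e _ ->] /imsetP[e' _ ->] ne.
have {}ne : e != e' by apply: contraNneq ne => ->.
have -> : ph e :&: ph e' = [set io v | v in ends e :&: ends e'].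
  apply/setP => y; rewrite inE; apply/andP/imsetP => [[ye ye']|[v + ->]].
    have /codomP[v yE] := sk_disj sk ye ye' ne.
    by exists v; rewrite // inE -!(sk_ends sk) -yE ye.
  by rewrite inE !(sk_ends sk) => /andP.
by rewrite (card_imset _ (sk_inj sk)) lin.
Qed.

Definition attach_ends (V E I : finType) (ends : E -> {set V}) (g : I -> V)
    (e : E + I) : {set V + I} :=
  match e with
  | inl e => [set inl v | v in ends e]
  | inr i => [set inl (g i); inr i]
  end.

Section AttachSkeleton.
Variables (m : nat) (V E I : finType) (ends : E -> {set V}) (K : hypergraph).
Variables (io : V -> K) (ph : E -> {set K}) (g : I -> V) (f : I -> K).
Variable (t : 'I_(m - 1)).
Hypothesis f_io : forall i, f i = io (g i).

(** Of the new vertices of each attached edge, the one numbered [t] is promoted to a skeleton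
    vertex; the others remain private. The attached edge thus has two ends, like an edge of a
    graph. *)
Definition attach_io (v : V + I) : attach m f :=
  match v with inl v => inl (io v) | inr i => inr (i, t) end.

Definition attach_ph (e : E + I) : {set attach m f} :=
  match e with
  | inl e => [set inl y | y in ph e]
  | inr i => attach_edge m f i
  end.

Lemma card_attach_edge i : (0 < m)%N -> #|attach_edge m f i| = m.
Proof.
move=> m0; rewrite cardsU1 card_imset => [|? ? [] //].
rewrite card_ord (_ : inl _ \notin _ = true) /=; last by apply/imsetP => -[].
by rewrite add1n subn1 prednK.
Qed.

Lemma in_attach_edge_inl i y : (inl y \in attach_edge m f i) = (y == f i).
Proof.
rewrite !inE (inj_eq (@inl_inj _ _)); case: eqP => //= _.
by apply/imsetP => -[].
Qed.

Lemma in_attach_edge_inr i j s : (inr (j, s) \in attach_edge m f i) = (j == i).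
Proof.
rewrite !inE /=; apply/imsetP/eqP => [[? _ [-> _]] //|->].
by exists s.
Qed.

Lemma attach_skeleton : (0 < m)%N -> skeleton m ends io ph ->
  skeleton m (attach_ends ends g) attach_io attach_ph.
Proof.
move=> m0 sk.
have inlE (S : {set K}) y : ((inl y : attach m f) \in [set inl z | z in S]) = (y \in S).
  by rewrite mem_imset //; apply: inl_inj.
have inrN (S : {set K}) z : ((inr z : attach m f) \in [set inl y | y in S]) = false.
  by apply/imsetP => -[].
have codl y : ((inl y : attach m f) \in codom attach_io) = (y \in codom io).
  apply/codomP/codomP => [[[v [->]|//]]|[v ->]]; first by exists v.
  by exists (inl v).
split.
- by move=> [v|i] [v'|i'] //= [] => [/(sk_inj sk)->|->].
- rewrite /= /attach_edges (sk_edges sk); apply/setP => S; rewrite inE.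
  apply/orP/imsetP => [[/imsetP[_ /imsetP[e _ ->] ->]|/imsetP[i _ ->]]|].
  + by exists (inl e).
  + by exists (inr i).
  + case=> -[e|i] _ ->; [left|right; exact: imset_f].
    by apply/imsetP; exists (ph e); rewrite ?imset_f.
- move=> [e|i] /=; last exact: card_attach_edge.
  by rewrite card_imset ?(sk_card sk) //; apply: inl_inj.
- move=> [e|i] [v|j] /=.
  + by rewrite inlE (sk_ends sk) mem_imset //; apply: inl_inj.
  + by rewrite inrN; apply/esym/imsetP => -[].
  + by rewrite in_attach_edge_inl f_io (inj_eq (sk_inj sk)) !inE orbF.
  + by rewrite in_attach_edge_inr !inE /=.
- move=> [e|i] [e'|i'] [y|[j s]] //=; rewrite ?inlE ?inrN // ?codl.
  + by move=> ye ye' ne; apply: (sk_disj sk ye ye').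
  + by rewrite in_attach_edge_inl => _ /eqP->; rewrite f_io codom_f.
  + by rewrite in_attach_edge_inl => /eqP-> _ _; rewrite f_io codom_f.
  + by rewrite in_attach_edge_inl => /eqP-> _ _; rewrite f_io codom_f.
  + by rewrite !in_attach_edge_inr => /eqP-> /eqP->; rewrite eqxx.
- move=> [y|[i s]].
    by rewrite codl => /(sk_cover sk)[e ye]; exists (inl e); rewrite /= inlE.
  by move=> _; exists (inr i); rewrite /= in_attach_edge_inr.
Qed.

End AttachSkeleton.

Lemma CL_skeleton m l : (2 <= m)%N -> (1 < l)%N ->
  skeleton m (@cycle_ends l) (inl : 'I_l -> CL m l) (@CL_edge m l).
Proof.
move=> m2 l1.
have inrE i j s : ((inr (j, s) : CL m l) \in CL_edge m i) = (j == i).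
  rewrite !inE /=; apply/imsetP/eqP => [[? _ [-> _]] //|->].
  by exists s.
have inlE i j : ((inl j : CL m l) \in CL_edge m i) = (j \in cycle_ends i).
  rewrite !inE (_ : inl j \in _ = false) ?orbF //.
  by apply/imsetP => -[].
split=> //.
- exact: inl_inj.
- move=> i; rewrite cardsU disjoint_setI0 ?cards0 ?subn0; last first.
    by rewrite disjoint_sym disjoints_subset; apply/subsetP => _ /imsetP[s _ ->]; rewrite !inE.
  rewrite cards2 (inj_eq (@inl_inj _ _)) eq_sym ordS_neq // card_imset => [|? ? []//].
  by rewrite card_ord subnKC.
- move=> i i' [j|[j s]]; rewrite ?codom_f //.
  by rewrite !inrE => /eqP-> /eqP->; rewrite eqxx.
- move=> [j|[j s]]; first by rewrite codom_f.
  by exists j; rewrite inrE.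
Qed.

(** Stated for any additive monoid so as to serve both degrees and quadratic forms. *)
Lemma attach_hedges_sum (R : nmodType) m (K : hypergraph) (I : finType) (f : I -> K)
    (g : {set attach m f} -> R) : (2 <= m)%N ->
  (\sum_(e in hedges (attach m f)) g e =
    \sum_(e in hedges K) g [set inl y | y in e] + \sum_i g (attach_edge m f i))%R.
Proof.
move=> m2; have t : 'I_(m - 1) by apply: Ordinal (_ : 0 < _)%N; rewrite subn_gt0.
have inl_inj' : injective (fun e : {set K} => [set (inl y : attach m f) | y in e]).
  by apply: imset_inj; apply: inl_inj.
have ae_inj : injective (attach_edge m f).
  move=> i j /setP/(_ (inr (i, t))); rewrite !in_attach_edge_inr eqxx.
  by move=> /esym/eqP.
rewrite /= /attach_edges.
rewrite (eq_bigl [predU [set [set inl y | y in (e : {set K})] | e in hedges K]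
  & [set attach_edge m f i | i : I]]); last by move=> e; rewrite inE.
rewrite bigU /=; last first.
  rewrite disjoints_subset; apply/subsetP => _ /imsetP[e _ ->]; rewrite inE.
  apply/imsetP => -[i _ /setP/(_ (inr (i, t)))].
  by rewrite in_attach_edge_inr eqxx => /imsetP[].
by rewrite !big_imset //= => e e' _ _; [apply: ae_inj|apply: inl_inj'].
Qed.

Lemma attach_linear m (K : hypergraph) (I : finType) (f : I -> K) :
  linear_hypergraph K -> linear_hypergraph (attach m f).
Proof.
move=> linK S S'; rewrite !inE.
have le_inl i (A : {set attach m f}) :
    (forall y, y \in A -> y \in attach_edge m f i -> exists z, y = inl z) ->
    (#|A :&: attach_edge m f i| <= 1)%N.
  move=> AP; rewrite -(cards1 (inl (f i) : attach m f)); apply: subset_leq_card.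
  apply/subsetP => y /setIP[yA yi]; have [z yE] := AP y yA yi.
  by move: yi; rewrite yE in_attach_edge_inl inE => /eqP->.
case/orP=> [/imsetP[e eK ->]|/imsetP[i _ ->]];
  case/orP=> [/imsetP[e' e'K ->]|/imsetP[j _ ->]] ne.
- rewrite -imsetI; last by move=> ? ? _ _ [].
  rewrite card_imset; last exact: inl_inj.
  by apply: linK => //; apply: contraNneq ne => ->.
- by apply: le_inl => _ /imsetP[y _ ->]; exists y.
- by rewrite setIC; apply: le_inl => _ /imsetP[y _ ->]; exists y.
- apply: le_inl => -[y|[k s]] //; first by exists y.
  by rewrite !in_attach_edge_inr => /eqP-> /eqP ij; rewrite ij eqxx in ne.
Qed.

Lemma attach_uniform m (K : hypergraph) (I : finType) (f : I -> K) :
  (0 < m)%N -> uniform m K -> uniform m (attach m f).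
Proof.
move=> m0 unifK S; rewrite !inE => /orP[/imsetP[e eK ->]|/imsetP[i _ ->]].
  by rewrite card_imset ?unifK //; apply: inl_inj.
exact: card_attach_edge.
Qed.

Lemma attach_degree m (K : hypergraph) (I : finType) (f : I -> K) y : (2 <= m)%N ->
  #|[set e in hedges (attach m f) | inl y \in e]| =
  (#|[set e in hedges K | y \in e]| + #|[set i | f i == y]|)%N.
Proof.
move=> m2; rewrite -!sum1_card.
rewrite (eq_bigl (fun e => (e \in hedges (attach m f)) && (inl y \in e))); last first.
  by move=> e; rewrite [in LHS]inE.
rewrite big_mkcondr /= (attach_hedges_sum (R := nat)) //; congr (_ + _)%N.
  rewrite [in RHS](eq_bigl (fun e => (e \in hedges K) && (y \in e))); last first.
    by move=> e; rewrite inE.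
  rewrite big_mkcondr; apply: eq_bigr => e _; rewrite mem_imset //; exact: inl_inj.
rewrite -big_mkcond; apply: eq_bigl => i.
by rewrite in_attach_edge_inl inE eq_sym.
Qed.

(** * Graph structure of a unicyclic power hypergraph *)

Lemma power_skeleton m (G : hypergraph) : (2 <= m)%N -> uniform 2 G ->
  skeleton m (fun e : {e : {set G} | e \in hedges G} => val e)
    (inl : G -> power m G) (@power_edge m G).
Proof.
move=> m2 G2.
have inrE e e' s : ((inr (e', s) : power m G) \in power_edge m e) = (e' == e).
  rewrite !inE; apply/orP/eqP => [[/imsetP[] //|/imsetP[? _ [-> _]] //]|->].
  by right; apply/imsetP; exists s.
have inlE e x : ((inl x : power m G) \in power_edge m e) = (x \in val e).
  rewrite !inE mem_imset; last exact: inl_inj.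
  by rewrite orbC; case: imsetP => [[? _]|].
split=> //.
- exact: inl_inj.
- move=> e; rewrite cardsU disjoint_setI0 ?cards0 ?subn0; last first.
    rewrite disjoints_subset; apply/subsetP => _ /imsetP[s _ ->].
    by rewrite !inE; apply/imsetP => -[].
  rewrite card_imset; last exact: inl_inj.
  by rewrite (G2 _ (valP e)) card_imset ?card_ord ?subnKC // => ? ? [].
- move=> e e' [x|[e'' s]]; rewrite ?codom_f //.
  by rewrite !inrE => /eqP-> /eqP->; rewrite eqxx.
- move=> [x|[e s]]; first by rewrite codom_f.
  by exists e; rewrite inrE.
Qed.

Lemma hiso_skeleton m (V E : finType) (ends : E -> {set V}) (H K : hypergraph)
    (io : V -> K) ph :
    hiso H K -> skeleton m ends io ph ->
  exists (io' : V -> H) ph', skeleton m ends io' ph'.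
Proof.
move=> [f [g fK gK] fE] sk.
have gI := can_inj gK.
exists (g \o io), (fun e => g @: ph e); split.
- exact: inj_comp gI (sk_inj sk).
- apply/setP => S; rewrite -fE (sk_edges sk); apply/imsetP/imsetP => -[e _].
    move=> fS; exists e => //; rewrite -fS -imset_comp.
    by rewrite -[LHS]imset_id; apply: eq_imset => y; rewrite /= fK.
  move=> ->; exists e => //; rewrite -imset_comp -[RHS]imset_id.
  by apply: eq_imset => y; rewrite /= gK.
- by move=> e; rewrite card_imset ?(sk_card sk).
- by move=> e v; rewrite /= mem_imset ?(sk_ends sk).
- move=> e e' _ /imsetP[y ye ->]; rewrite mem_imset // => ye' ne.
  have /codomP[v ->] := sk_disj sk ye ye' ne.
  exact: (codom_f (g \o io)).
- move=> y yio; have yio' : f y \notin codom io.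
    apply: contra yio => /codomP[v fy].
    by rewrite -(fK y) fy; apply: (codom_f (g \o io)).
  have [e ye] := sk_cover sk yio'; exists e.
  by rewrite -(fK y) mem_imset.
Qed.

(** Encodes a unicyclic graph: the cycle, and for every other vertex the edge to its parent. So [N]
    also indexes the off-cycle edges, and a rank that decreases towards parents guarantees that
    parents lead to the cycle. *)
Definition tree_ends l (N : finType) (par : N -> 'I_l + N) (e : 'I_l + N) :
    {set 'I_l + N} :=
  match e with
  | inl i => [set inl i; inl (ordS i)]
  | inr n => [set inr n; par n]
  end.

Section TreeEnds.
Variables (l : nat) (N : finType) (par : N -> 'I_l + N) (rk : N -> nat).
Hypothesis l_gt2 : (2 < l)%N.
Hypothesis rkP : forall n n', par n = inr n' -> (rk n' < rk n)%N.

Lemma parN n : par n != inr n.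
Proof. by apply/eqP => /rkP; rewrite ltnn. Qed.

Lemma tree_ends2 e : #|tree_ends par e| = 2%N.
Proof.
case: e => [i|n] /=; rewrite cards2.
  by rewrite (inj_eq (@inl_inj _ _)) eq_sym ordS_neq // ltnW.
by rewrite eq_sym parN.
Qed.

(** Two off-cycle edges with the same ends would make two vertices parents of each other, against
    the rank; two such cycle edges would force l = 2. *)
Lemma tree_ends_inj : injective (tree_ends par).
Proof.
have neq i n : tree_ends par (inl i) <> tree_ends par (inr n).
  by move=> /setP/(_ (inr n)); rewrite !inE eqxx.
move=> [i|n] [j|n'] eE.
- move/setP: eE => /= eE.
  have := eE (inl i); have := eE (inl j); rewrite !inE !(inj_eq (@inl_inj _ _)) !eqxx /=.
  move=> /orP[/eqP-> //|/eqP jE] /esym/orP[/eqP-> //|/eqP iE].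
  by have := ordSS_neq i l_gt2; rewrite -jE -iE eqxx.
- by case: (neq _ _ eE).
- by case: (neq _ _ (esym eE)).
- move/setP: eE => /= eE.
  have := eE (inr n); have := eE (inr n'); rewrite !inE !eqxx /=.
  move=> /orP[/eqP-> //|/eqP nE] /esym/orP[/eqP-> //|/eqP n'E].
  by have := ltn_trans (rkP (esym nE)) (rkP (esym n'E)); rewrite ltnn.
Qed.

End TreeEnds.

Section GraphSkeleton.
Variables (m : nat) (V E : finType) (ends : E -> {set V}) (H : hypergraph).
Variables (io : V -> H) (ph : E -> {set H}).
Hypothesis sk : skeleton m ends io ph.
Hypotheses (ends2 : forall e, #|ends e| = 2) (ends_inj : injective ends).

Lemma skeleton_ph_inj : injective ph.
Proof.
move=> e e' phE; apply: ends_inj; apply/setP => v.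
by rewrite -!(sk_ends sk) phE.
Qed.

Lemma ends_eq e a b : a \in ends e -> b \in ends e -> a != b -> ends e = [set a; b].
Proof.
move=> ae be ab; apply/esym/eqP; rewrite eqEcard cards2 ab ends2 leqnn andbT.
by apply/subsetP => v /set2P[]->.
Qed.

Definition graph_adj : rel V := fun a b => [exists e, ends e == [set a; b]].

Lemma skeleton_connected : connected_hypergraph H -> forall a b, connect graph_adj a b.
Proof.
move=> conH a b.
(* A retraction onto [V]: a private vertex goes to an end of its only edge. It turns each step of a
   path in [H] into an edge of the graph or a standstill. *)
have [pr prP] : exists pr : H -> V, (forall v, pr (io v) = v) /\
    forall y e, y \in ph e -> pr y \in ends e.
  have /fin_all_exists[pr prP] : forall y, exists v,
      (forall v', y = io v' -> v' = v) /\ forall e, y \in ph e -> v \in ends e.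
    move=> y; case: (boolP (y \in codom io)) => [/codomP[v ->]|yio].
      exists v; split=> [v' /(sk_inj sk)->//|e]; by rewrite (sk_ends sk).
    have [e ye] := sk_cover sk yio.
    have /card_gt0P[v ve] : 0 < #|ends e| by rewrite ends2.
    exists v; split=> [v' yE|e' ye']; first by rewrite yE codom_f in yio.
    suff -> : e' = e by [].
    by apply/eqP; apply: contraNT yio; apply: (sk_disj sk ye' ye).
  exists pr; split=> [v|y e]; last by have [_] := prP y; apply.
  by have [/(_ v erefl)] := prP (io v).
have [pr_io pr_ph] := prP.
have /connectP[p pth lst] := conH (io a) (io b).
rewrite -(pr_io a) -(pr_io b).
elim: p (io a) pth lst => [|y p IHp] x /=; first by move=> _ ->.
move=> /andP[/andP[_ /exists_inP[S]]]; rewrite (sk_edges sk) => /imsetP[e _ ->].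
move=> /andP[xe ye] /IHp{}IHp /IHp; apply: connect_trans.
case: (eqVneq (pr x) (pr y)) => [->|ne]; first exact: connect0.
apply: connect1; apply/existsP; exists e; apply/eqP.
by apply: ends_eq ne; apply: pr_ph.
Qed.

Lemma skeleton_cycle_of_length L (c : 'I_L -> V) (ce : 'I_L -> E) :
    (2 < L)%N -> injective c -> (forall i, ends (ce i) = [set c i; c (ordS i)]) ->
  cycle_of_length L [set ph (ce i) | i : 'I_L].
Proof.
move=> L3 c_inj ceE; exists (io \o c), (ph \o ce); split=> //.
have ioce i v : (io v \in ph (ce i)) = (v == c i) || (v == c (ordS i)).
  by rewrite (sk_ends sk) ceE !inE.
have ce_inj : injective ce.
  move=> i j ij; have := ceE j; rewrite -ij ceE => /setP cE.
  have := cE (c i); rewrite !inE eqxx !(inj_eq c_inj) => /esym/orP[/eqP//|/eqP iE].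
  have := cE (c j); rewrite !inE eqxx !(inj_eq c_inj) => /orP[/eqP//|/eqP jE].
  by have := ordSS_neq i L3; rewrite -jE -iE eqxx.
have inI i j y : j != i -> y \in ph (ce i) -> y \in ph (ce j) ->
    exists2 v, y = io v
      & ((v == c i) || (v == c (ordS i))) && ((v == c j) || (v == c (ordS j))).
  move=> ji yi yj; have ne : ce i != ce j by rewrite (inj_eq ce_inj) eq_sym.
  have /codomP[v yE] := sk_disj sk yi yj ne.
  by exists v; rewrite // -!ioce -yE yi.
split=> //.
- by split; [apply: inj_comp (sk_inj sk) c_inj|apply: inj_comp skeleton_ph_inj ce_inj].
- by move=> i; rewrite (sk_edges sk) /= imset_f.
- move=> i; apply/setP => y; rewrite !inE; apply/andP/eqP => [[yp yi]|->]; last first.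
    by rewrite /= !ioce ord_predK eqxx orbT.
  have ne : i != ord_pred i by rewrite eq_sym ord_pred_neq // ltnW.
  have [v -> /=] := inI _ _ _ ne yp yi; rewrite ord_predK.
  case: (eqVneq v (c i)) => [-> //|_ /=]; rewrite orbF => /andP[/eqP-> /eqP/c_inj].
  by move/esym/eqP; rewrite (negbTE (ordS_ord_pred_neq _ _)).
- move=> i j ji jS jP; rewrite disjoints_subset; apply/subsetP => y yi.
  rewrite inE; apply/negP => yj; have [v _] := inI _ _ _ ji yi yj.
  case/andP=> /orP[] /eqP->; rewrite !(inj_eq c_inj) => /orP[] /eqP ij.
  + by rewrite ij eqxx in ji.
  + by rewrite ij ordSK eqxx in jP.
  + by rewrite ij eqxx in jS.
  + by rewrite (ordS_inj ij) eqxx in ji.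
Qed.

Lemma cycle_of_length_skeleton l S : cycle_of_length l S ->
  (2 < l)%N /\ exists (c : 'I_l -> V) (ce : 'I_l -> E),
   [/\ injective c, injective ce,
       forall i, ends (ce i) = [set c i; c (ordS i)] & S = [set ph (ce i) | i : 'I_l]].
Proof.
move=> [v [e [[l3 [v_inj e_inj] eH eI _] SE]]]; split=> //.
have vin i : v i \in e i.
  by have /setP/(_ (v i)) := eI i; rewrite !inE eqxx => /andP[].
have vSin i : v (ordS i) \in e i.
  by have /setP/(_ (v (ordS i))) := eI (ordS i); rewrite ordSK !inE eqxx => /andP[].
have /fin_all_exists[ce ceP] : forall i, exists x, e i = ph x.
  by move=> i; have := eH i; rewrite (sk_edges sk) => /imsetP[x _ ->]; exists x.
have ce_inj : injective ce by move=> i j ij; apply: e_inj; rewrite !ceP ij.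
(* A core vertex of the loose cycle lies in two different edges, so it is not private. *)
have /fin_all_exists[c cP] : forall i, exists x, v i = io x.
  move=> i; have ne : ce (ord_pred i) != ce i.
    by rewrite (inj_eq ce_inj) ord_pred_neq // ltnW.
  have v1 : v i \in ph (ce (ord_pred i)) by rewrite -ceP -{1}(ord_predK i) vSin.
  have v2 : v i \in ph (ce i) by rewrite -ceP.
  by have /codomP := sk_disj sk v1 v2 ne.
have c_inj : injective c by move=> i j ij; apply: v_inj; rewrite !cP ij.
exists c, ce; split=> // [i|]; last by rewrite SE; apply: eq_imset.
apply: ends_eq; rewrite -?(sk_ends sk) -?cP -?ceP //.
by rewrite (inj_eq c_inj) eq_sym ordS_neq // ltnW.
Qed.

(** The rank is the distance to [A]: a vertex first reached by the ball of radius k + 1 has a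
    neighbour in the ball of radius k. *)
Lemma ranked_parents (A : {set V}) : A != set0 -> (forall a b, connect graph_adj a b) ->
  exists rk : V -> nat, forall v, v \notin A ->
    exists e a, ends e = [set v; a] /\ (rk a < rk v)%N.
Proof.
move=> /set0Pn[a0 a0A] con.
pose ball k := iter k (fun B => B :|: [set v | [exists a in B, graph_adj a v]]) A.
have ballS k : ball k.+1 = ball k :|: [set v | [exists a in ball k, graph_adj a v]] by [].
have ex v : exists k, v \in ball k.
  have /connectP[p] := con a0 v; have : a0 \in ball 0 by [].
  move: 0 => k; elim: p a0 k {a0A} => [|b p IHp] a k ak /=; first by move=> _ ->; exists k.
  move=> /andP[ab pth] lst; apply: (IHp b k.+1) => //.
  by rewrite ballS !inE; apply/orP; right; apply/exists_inP; exists a.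
exists (fun v => ex_minn (ex v)) => v vA.
case: ex_minnP => -[|k] vk kmin; first by rewrite vk in vA.
move: vk; rewrite ballS !inE => /orP[/kmin|/exists_inP[a ak /existsP[e /eqP eE]]].
  by rewrite ltnn.
exists e, a; split; first by rewrite eE setUC.
by case: ex_minnP => j _ /(_ _ ak).
Qed.

(** Each vertex off the cycle selects an edge to a vertex nearer to the cycle. These edges and the
    cycle edges are distinct and connect everything, so any further edge would close a second
    cycle. *)
Lemma unicyclic_graph_skeleton l : connected_hypergraph H -> unicyclic H ->
    (exists S, @cycle_of_length H l S) ->
  (2 < l)%N /\ exists (N : finType) (par : N -> 'I_l + N) (rk : N -> nat)
    (io' : 'I_l + N -> H) ph',
    (forall n n', par n = inr n' -> (rk n' < rk n)%N) /\
    skeleton m (tree_ends par) io' ph'.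
Proof.
move=> conH [S0 [_ S0uniq]] [S Scyc].
have SS0 : S0 = S by apply: S0uniq; exists l.
have [l3 [c [ce [c_inj ce_inj ceE SE]]]] := cycle_of_length_skeleton Scyc.
split=> //; have l0 : (0 < l)%N by apply: ltn_trans l3.
pose i0 := Ordinal l0.
pose A := [set c i | i : 'I_l].
have A0 : A != set0 by apply/set0Pn; exists (c i0); rewrite imset_f.
have con := skeleton_connected conH.
have [rk rkP] := ranked_parents A0 con.
pose N := {v : V | v \notin A}.
have /fin_all_exists[pe peP] : forall n : N, exists e, exists a,
    ends e = [set val n; a] /\ (rk a < rk (val n))%N.
  by move=> n; apply: rkP (valP n).
have /fin_all_exists[pv pvP] := peP.
pose hV (z : 'I_l + N) : V := match z with inl i => c i | inr n => val n end.
have [gV hVK gVK] : bijective hV.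
  apply: inj_card_bij.
    move=> [i|n] [j|n'] /=; first by move/c_inj->.
    - by move=> E0; have := valP n'; rewrite /= -E0 imset_f.
    - by move=> E0; have := valP n; rewrite /= E0 imset_f.
    - by move/val_inj->.
  rewrite card_sum card_ord card_sig -(cardC A) card_imset // card_ord leq_add2l.
  by apply: eq_leq; apply: eq_card => v; rewrite !inE.
pose par n := gV (pv n).
pose hE (z : 'I_l + N) : E := match z with inl i => ce i | inr n => pe n end.
have hEends z v : (hV v \in ends (hE z)) = (v \in tree_ends par z).
  case: z => [i|n] /=.
    rewrite ceE !inE -[c i]/(hV (inl i)) -[c (ordS i)]/(hV (inl (ordS i))).
    by rewrite !(can_eq hVK).
  rewrite (proj1 (pvP n)) !inE -[val n]/(hV (inr n)) (can_eq hVK); congr (_ || _).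
  by rewrite -(can_eq gVK) hVK.
have par_neq n : pv n != val n.
  by apply/eqP => E0; have [_] := pvP n; rewrite E0 ltnn.
have hE_inj : injective hE.
  have cN i n : ce i <> pe n.
    move=> E0; have : val n \in ends (ce i) by rewrite E0 (proj1 (pvP n)) set21.
    rewrite ceE !inE => /orP[] /eqP nE; have := valP n; by rewrite /= nE imset_f.
  move=> [i|n] [j|n'] /= E0; first by rewrite (ce_inj _ _ E0).
  - by case: (cN i n').
  - by case: (cN j n).
  - congr inr; apply: val_inj; have [e1 r1] := pvP n; have [e2 r2] := pvP n'.
    have : val n \in ends (pe n') by rewrite -E0 e1 set21.
    rewrite e2 => /set2P[-> //|nE].
    have : val n' \in ends (pe n) by rewrite E0 e2 set21.
    rewrite e1 => /set2P[-> //|n'E].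
    by rewrite -n'E in r1; rewrite -nE in r2; have := ltn_trans r1 r2; rewrite ltnn.
(* Join the ends of a missing edge [f0] by a simple path of selected edges. Together with [f0] it is
   a cycle, which must be the given one by uniqueness; but all edges of that one are selected. *)
have hE_surj f0 : f0 \in codom hE.
  apply/negPn/negP => f0N.
  pose adj' a b := [exists z, ends (hE z) == [set a; b]].
  have adjC : symmetric adj' by move=> a b; rewrite /adj' setUC.
  have conC : connect_sym adj' by exact: sym_connect_sym.
  have con' v : connect adj' v (c i0).
    have conc i : connect adj' (c i) (c i0).
      have [k ->] := iter_ordS_trans i0 i; elim: k => [|k IHk] /=; first exact: connect0.
      apply: connect_trans IHk; rewrite conC; apply: connect1.
      by apply/existsP; exists (inl (iter k (@ordS l) i0)); rewrite /= ceE.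
    have [k] := ubnP (rk v); elim: k v => // k IHk v; rewrite ltnS => vk.
    rewrite -(gVK v) in vk *; case: (gV v) vk => [i|n] /= vk; first exact: conc.
    have [e1 r1] := pvP n.
    apply: connect_trans (IHk (pv n) (leq_trans r1 vk)).
    by apply: connect1; apply/existsP; exists (inr n); rewrite /= e1.
  have /cards2P[a [b [ab f0E]]] : #|ends f0| == 2 by rewrite ends2.
  have nadj : ~~ adj' a b.
    apply: contra f0N => /existsP[z /eqP zE].
    by apply/codomP; exists z; apply: ends_inj; rewrite zE.
  have /connectP[p0] : connect adj' a b.
    by apply: connect_trans (con' a) _; rewrite conC.
  case/shortenP => p pth pu _ bE {p0}.
  (* A path of length one would be a selected edge with the ends of [f0], hence [f0] itself. So the
     closed cycle, whose vertices are [a :: p], has length at least 3; its last edge is [f0]. *)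
  have p2 : (1 < size p)%N.
    case: p pth pu bE => [|x [|y p]] //=; first by move=> _ _ E0; rewrite E0 eqxx in ab.
    by rewrite andbT => + _ E0; rewrite -E0 (negbTE nadj).
  pose L := (size p).+1; pose c' (i : 'I_L) := nth a (a :: p) i.
  have c'_inj : injective c'.
    by move=> i j /eqP; rewrite nth_uniq // => /eqP/ord_inj.
  have c'_step (i : 'I_L) : i.+1 != L -> adj' (c' i) (c' (ordS i)).
    move=> iL; have ilt : i < size p.
      by have := ltn_ord i; rewrite leq_eqVlt (negbTE iL).
    rewrite /c' val_ordS (negbTE iL) /=.
    by have /(pathP a) := pth; apply.
  have c'_last (i : 'I_L) : i.+1 == L -> ends f0 = [set c' i; c' (ordS i)].
    move=> iL; rewrite /c' val_ordS iL f0E setUC bE (last_nth a).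
    have -> : i = size p :> nat by case: (eqP iL).
    by [].
  have /fin_all_exists[ce' ce'P] : forall i : 'I_L, exists e,
      ends e = [set c' i; c' (ordS i)] /\ (i.+1 == L -> e = f0).
    move=> i; case: (boolP (i.+1 == L)) => [iL|/c'_step/existsP[z /eqP zE]].
      by exists f0; split=> //; apply: c'_last.
    by exists (hE z).
  have ce'E i : ends (ce' i) = [set c' i; c' (ordS i)] by have [] := ce'P i.
  have S'cyc := @skeleton_cycle_of_length L c' ce' p2 c'_inj ce'E.
  have S'S : S = [set ph (ce' i) | i : 'I_L].
    by rewrite -SS0; apply: S0uniq; exists L.
  have : ph f0 \in S.
    rewrite S'S; apply/imsetP; exists ord_max => //.
    by have [_ ->] := ce'P ord_max.
  rewrite SE => /imsetP[i _ /skeleton_ph_inj f0i].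
  by case/codomP: f0N; exists (inl i).
have hE_bij : bijective hE.
  apply: (inj_card_bij hE_inj).
  rewrite -(card_codom hE_inj); apply: subset_leq_card.
  by apply/subsetP => e _.
exists N, par, (fun n => rk (val n)), (io \o hV), (ph \o hE); split.
  move=> n n' pE; have [_] := pvP n.
  by rewrite -(gVK (pv n)) -/(par n) pE.
apply: skeleton_relabel sk => //; first by exists gV.
Qed.

End GraphSkeleton.

Lemma unicyclic_skeleton m l (H : hypergraph) : (2 <= m)%N -> is_power m H ->
    connected_hypergraph H -> unicyclic H -> (exists S, @cycle_of_length H l S) ->
  (2 < l)%N /\ exists (N : finType) (par : N -> 'I_l + N) (rk : N -> nat)
    (io : 'I_l + N -> H) ph,
    (forall n n', par n = inr n' -> (rk n' < rk n)%N) /\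
    skeleton m (tree_ends par) io ph.
Proof.
move=> m2 [G G2 HG] conH uniH cycH.
have [io [ph sk]] := hiso_skeleton HG (power_skeleton m2 G2).
apply: (unicyclic_graph_skeleton sk) conH uniH cycH.
  by move=> e; apply: G2 (valP e).
exact: val_inj.
Qed.

(** * Recognition of the comparison hypergraphs *)

Definition UC_root m l c (p : UC_pendant l c) : CL m l := inl (tag p).

Definition UC_io m l c (t : 'I_(m - 1)) : 'I_l + UC_pendant l c -> UC m l c :=
  attach_io (inl : 'I_l -> CL m l) (@UC_root m l c) t.

Lemma UC_skeleton m l c (t : 'I_(m - 1)) : (2 <= m)%N -> (1 < l)%N ->
  skeleton m (attach_ends (@cycle_ends l) (fun p : UC_pendant l c => tag p))
    (@UC_io m l c t) (attach_ph m (@CL_edge m l : _ -> {set CL m l}) (@UC_root m l c)).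
Proof.
move=> m2 l1; apply: (attach_skeleton t _ (ltnW m2) (CL_skeleton m2 l1)).
by [].
Qed.

Lemma UC_linear m l c : (2 <= m)%N -> (2 < l)%N -> linear_hypergraph (UC m l c).
Proof.
move=> m2 l3; apply: attach_linear.
apply: (skeleton_linear (CL_skeleton m2 (ltnW l3))) => i j.
have c2 (a : 'I_l) : #|cycle_ends a| = 2%N by rewrite cards2 eq_sym ordS_neq // ltnW.
apply: contraNleq => lt1; rewrite -(inj_eq (cycle_ends_inj l3)).
have /eqP <- : cycle_ends i :&: cycle_ends j == cycle_ends i.
  by rewrite eqEcard subsetIl c2.
by rewrite eqEcard subsetIr c2.
Qed.

Lemma UC_uniform m l c : (2 <= m)%N -> (1 < l)%N -> uniform m (UC m l c).
Proof.
move=> m2 l1; apply: attach_uniform; first exact: ltnW.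
move=> S; rewrite (sk_edges (CL_skeleton m2 l1)) => /imsetP[i _ ->].
exact: (sk_card (CL_skeleton m2 l1)).
Qed.

Lemma UC_degree m l c (i : 'I_l) : (2 <= m)%N -> (2 < l)%N ->
  #|[set e in hedges (UC m l c) | inl (inl i) \in e]| =
  (2 + #|[set p : UC_pendant l c | tag p == i]|)%N.
Proof.
move=> m2 l3; rewrite attach_degree //; congr (_ + _)%N.
have sk := CL_skeleton m2 (ltnW l3).
have CL_inj : injective (@CL_edge m l).
  move=> a b ab; apply: (cycle_ends_inj l3); apply/setP => x.
  by rewrite -!(sk_ends sk) ab.
have -> : [set e in hedges (CL m l) | inl i \in e] =
    [set CL_edge m i; CL_edge m (ord_pred i)].
  apply/setP => S; rewrite !inE (sk_edges sk); apply/andP/orP.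
    case=> /imsetP[j _ ->]; rewrite (sk_ends sk) !inE => /orP[]/eqP->; first by left.
    by right; rewrite ordSK.
  by case=> /eqP->; rewrite imset_f //= (sk_ends sk) !inE ?ord_predK eqxx ?orbT.
by rewrite cards2 (inj_eq CL_inj) eq_sym ord_pred_neq // ltnW.
Qed.

Lemma tag_UC_pendant1 l a (p : UC_pendant l [:: a]) : tag p = 0 :> nat.
Proof. by case: p => -[[|i] il] [q qlt] //=; move: qlt; rewrite /= nth_nil. Qed.

Lemma card_UC_pendant1 l a : (0 < l)%N -> #|{: UC_pendant l [:: a]}| = a.
Proof.
case: l => // l _; rewrite card_tagged sumnE big_map big_enum /=.
rewrite (bigD1 ord0) //= card_ord big1 ?addn0 // => -[[|i] il] // _.
by rewrite card_ord /= nth_nil.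
Qed.

Lemma card_UC_pendant2 l a : (1 < l)%N -> #|{: UC_pendant l [:: a; 1%N]}| = a.+1.
Proof.
case: l => [//|[//|l]] _; rewrite card_tagged sumnE big_map big_enum /=.
rewrite (bigD1 ord0) //= card_ord (bigD1 (lift ord0 ord0)) //= card_ord.
rewrite big1 => [|[[|[|i]] il] //= _]; first by rewrite /= addn0 addn1.
by rewrite card_ord /= nth_nil.
Qed.

Section TreeTargets.
Variables (m l : nat) (N : finType) (par : N -> 'I_l + N) (H : hypergraph).
Variables (io : 'I_l + N -> H) (ph : 'I_l + N -> {set H}) (t : 'I_(m - 1)).
Hypotheses (m2 : (2 <= m)%N) (l_gt2 : (2 < l)%N).
Hypothesis sk : skeleton m (tree_ends par) io ph.
Variables (s sE : 'I_l -> 'I_l).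
Hypothesis s_auto : cycle_auto s sE.

(** Serves both excluded hypergraphs, in which every off-cycle edge hangs directly on the cycle. *)
Lemma UC_hiso c (f : N -> 'I_l) (h : N -> UC_pendant l c) :
    (forall n, par n = inl (f n)) -> bijective h -> (forall n, tag (h n) = s (f n)) ->
  hiso H (UC m l c).
Proof.
move=> parE h_bij hE; have [s_bij sE_bij s_ends] := s_auto.
have skU := UC_skeleton c t m2 (ltnW l_gt2).
pose hv (g : 'I_l -> 'I_l) (v : 'I_l + N) : 'I_l + UC_pendant l c :=
  match v with inl i => inl (g i) | inr n => inr (h n) end.
have hv_bij g : bijective g -> bijective (hv g).
  move=> [g' gK g'K]; have [h' hK h'K] := h_bij.
  exists (fun v => match v with inl i => inl (g' i) | inr p => inr (h' p) end).
    by move=> [i|n] /=; rewrite ?gK ?hK.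
  by move=> [i|n] /=; rewrite ?g'K ?h'K.
have ends_E e v : (hv s v \in
    attach_ends (@cycle_ends l) (fun p : UC_pendant l c => tag p) (hv sE e))
    = (v \in tree_ends par e).
  case: e v => [i|n] [j|n'] /=.
  - by rewrite mem_imset ?s_ends ?inE ?(inj_eq (@inl_inj _ _)) //; apply: inl_inj.
  - by rewrite !inE; apply/imsetP => -[].
  - by rewrite parE hE !inE ?(inj_eq (@inl_inj _ _)) orbF (inj_eq (bij_inj s_bij)).
  - by rewrite parE !inE !(inj_eq (@inr_inj _ _)) orbF (inj_eq (bij_inj h_bij)).
have skU' := skeleton_relabel (hv_bij _ s_bij) (hv_bij _ sE_bij) ends_E skU.
have i0 : 'I_l by apply: Ordinal (_ : 0 < l)%N; apply: ltn_trans l_gt2.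
have [f' [f_bij f_edges] _] := skeleton_iso (io (inl i0)) (inl (inl i0) : UC m l c) sk skU'.
by exists f'.
Qed.

Variables (a : nat) (k : N -> UC_pendant l [:: a] + unit) (n1 : N) (i0 : 'I_l).
Hypotheses (k_bij : bijective k) (kn1 : k n1 = inr tt).
Hypotheses (par_i0 : forall n, n != n1 -> par n = inl i0) (s_i0 : s i0 = 0 :> nat).

(** One map for vertices and edges: take [g] to be [s] for the former and [sE] for the latter. Off
    the cycle the two agree, since an edge is named by its lower vertex. *)
Definition extra_vertex (g : 'I_l -> 'I_l) (v : 'I_l + N) :
    ('I_l + UC_pendant l [:: a]) + unit :=
  match v with
  | inl i => inl (inl (g i))
  | inr n => match k n with inl p => inl (inr p) | inr u => inr u end
  end.

Lemma extra_vertex_bij g : bijective g -> bijective (extra_vertex g).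
Proof.
move=> [g' gK g'K]; have [k' kK k'K] := k_bij.
exists (fun v => match v with
  | inl (inl i) => inl (g' i)
  | inl (inr p) => inr (k' (inl p))
  | inr u => inr (k' (inr u))
  end).
  move=> [i|n] /=; first by rewrite gK.
  by case E: (k n) => [p|u]; rewrite -E kK.
by move=> [[i|p]|u] /=; rewrite ?g'K ?k'K.
Qed.

(** All off-cycle edges but one hang on [i0]; the place [va] of the last one is left open. A leaf
    yields U_lC, a cycle vertex the hypergraph from which the edge will be moved. *)
Lemma attached_UC_iso (va : 'I_l + UC_pendant l [:: a])
    (va_io := @UC_io m l [:: a] t) :
    extra_vertex s (par n1) = inl va ->
  exists2 f : H -> attach m (fun _ : unit => va_io va),
    bijective f /\ (forall e : {set H},
      (f @: e \in hedges (attach m (fun _ : unit => va_io va))) = (e \in hedges H))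
    & forall v, f (io v) = attach_io va_io (fun _ : unit => va_io va) t (extra_vertex s v).
Proof.
move=> parn1; have [s_bij sE_bij s_ends] := s_auto.
have skU := UC_skeleton [:: a] t m2 (ltnW l_gt2).
have skK := attach_skeleton (f := fun _ : unit => va_io va) (g := fun=> va) t
  (fun=> erefl) (ltnW m2) skU.
have exI g : bijective g -> injective (extra_vertex g) by move=> /extra_vertex_bij/bij_inj.
have ends_E e v : (extra_vertex s v \in
    attach_ends (attach_ends (@cycle_ends l) (fun p : UC_pendant l [:: a] => tag p))
      (fun _ : unit => va) (extra_vertex sE e)) = (v \in tree_ends par e).
  case: e => [i|n].
    rewrite /= !inE; case: v => [j|n'] /=.
      rewrite !mem_imset; [|exact: inl_inj|exact: inl_inj].
      by rewrite s_ends !inE !(inj_eq (@inl_inj _ _)).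
    apply/imsetP => -[v /imsetP[j _ ->]].
    by case: (k n').
  have exr : extra_vertex sE (inr n) = extra_vertex s (inr n) by [].
  have -> : (v \in tree_ends par (inr n)) =
      (extra_vertex s v == extra_vertex s (inr n)) ||
      (extra_vertex s v == extra_vertex s (par n)).
    by rewrite !inE !(inj_eq (exI _ s_bij)).
  rewrite {}exr; move: (extra_vertex s v) => z; case: (eqVneq n n1) => [->|nn1].
    by rewrite parn1 /= kn1 /= !inE orbC.
  have [p kn] : exists p, k n = inl p.
    case E: (k n) => [p|[]]; first by exists p.
    by case/eqP: nn1; apply: (bij_inj k_bij); rewrite E kn1.
  have tp : tag p = s i0 by apply: ord_inj; rewrite s_i0 tag_UC_pendant1.
  by rewrite par_i0 //= kn /= tp imsetU !imset_set1 !inE orbC.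
have skK' := skeleton_relabel (extra_vertex_bij s_bij) (extra_vertex_bij sE_bij) ends_E skK.
exact: skeleton_iso (io (inl i0))
  (inl (inl (inl i0)) : attach m (fun _ : unit => va_io va)) sk skK'.
Qed.

End TreeTargets.

(** Any bijection, corrected by two transpositions; the second one fixes [b1]. *)
Lemma prescribed_bijection (A B : finType) (a1 a2 : A) (b1 b2 : B) :
    #|A| = #|B| -> a1 != a2 -> b1 != b2 ->
  exists h : A -> B, [/\ bijective h, h a1 = b1 & h a2 = b2].
Proof.
move=> AB a12 b12.
pose h0 x := enum_val (cast_ord AB (enum_rank x)).
have h0_inj : injective h0.
  by move=> x y /enum_val_inj/cast_ord_inj/enum_rank_inj.
have h0_bij : bijective h0 by apply: inj_card_bij; rewrite ?AB.
pose h1 := tperm (h0 a1) b1 \o h0.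
have h1a1 : h1 a1 = b1 by rewrite /h1 /= tpermL.
have h1_bij : bijective h1 by apply: bij_comp h0_bij; apply: injF_bij; apply: perm_inj.
exists (tperm (h1 a2) b2 \o h1); split.
- by apply: bij_comp h1_bij; apply: injF_bij; apply: perm_inj.
- rewrite /= h1a1 tpermD // 1?eq_sym // -h1a1 (inj_eq (bij_inj h1_bij)) //.
- by rewrite /= tpermL.
Qed.

Local Open Scope ring_scope.

(** * Real elements of a closed field and Perron vectors *)

(** The order of [C] is only partial. Its real elements form a totally ordered field, in which
    maxima can be taken and linear arithmetic applies. *)
Record creal (C : numClosedFieldType) :=
  CReal { creal_val :> C; _ : creal_val \is Num.real }.

Section CrealInstances.
Variable C : numClosedFieldType.

HB.instance Definition _ := [isSub for @creal_val C].
HB.instance Definition _ := [Choice of creal C by <:].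
HB.instance Definition _ := [SubChoice_isSubIntegralDomain of creal C by <:].
HB.instance Definition _ := [SubIntegralDomain_isSubField of creal C by <:].
HB.instance Definition _ : Order.isPOrder ring_display (creal C) :=
  Order.CancelPartial.Pcan _ valK.

Lemma creal_total : total (<=%O : rel (creal C : porderType _)).
Proof. by move=> x y; apply/real_leVge/valP/valP. Qed.

HB.instance Definition _ := Order.POrder_isTotal.Build _ (creal C) creal_total.

Lemma creal_val_zmod : zmod_morphism (@creal_val C). Proof. by []. Qed.

Lemma creal_val_monoid : monoid_morphism (@creal_val C). Proof. by []. Qed.

HB.instance Definition _ :=
  GRing.isZmodMorphism.Build (creal C) C (@creal_val C) creal_val_zmod.
HB.instance Definition _ :=
  GRing.isMonoidMorphism.Build (creal C) C (@creal_val C) creal_val_monoid.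

Definition creal_norm (x : creal C) : creal C := CReal (normr_real (val x)).

Lemma creal_normD x y : creal_norm (x + y) <= (creal_norm x + creal_norm y).
Proof. exact: ler_normD. Qed.

Lemma creal_norm0_eq0 x : creal_norm x = 0 -> x = 0.
Proof. by move=> /(congr1 val)/normr0_eq0 ?; apply/val_inj. Qed.

Lemma creal_normMn x n : creal_norm (x *+ n) = creal_norm x *+ n.
Proof. by apply/val_inj; rewrite /= !rmorphMn/= normrMn. Qed.

Lemma creal_normN x : creal_norm (- x) = creal_norm x.
Proof. by apply/val_inj; apply: normrN. Qed.

Let z : creal C := 0.

Lemma creal_addr_gt0 (x y : creal C) : z < x -> z < y -> z < x + y.
Proof. exact: addr_gt0. Qed.

Lemma creal_ger_leVge (x y : creal C) :
  z <= x -> z <= y -> (x <= y) || (y <= x).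
Proof. exact: ger_leVge. Qed.

Lemma creal_normM : {morph creal_norm : x y / x * y}.
Proof. by move=> x y; apply/val_inj; apply: normrM. Qed.

Lemma creal_ler_def (x y : creal C) : (x <= y) = (creal_norm (y - x) == y - x).
Proof. exact: ler_def. Qed.

HB.instance Definition _ := Num.Zmodule_isNormed.Build _ (creal C)
  creal_normD creal_norm0_eq0 creal_normMn creal_normN.
HB.instance Definition _ := Num.isNumRing.Build (creal C)
  creal_addr_gt0 creal_ger_leVge creal_normM creal_ler_def.

End CrealInstances.

Section SpectralRadius.
Variables (C : numClosedFieldType) (n : nat).
Implicit Types (A : 'M[C]_n) (u : 'rV[C]_n).
Local Open Scope sesquilinear_scope.

Lemma mem_eigenvalues A z : (z \in eigenvalues A) = eigenvalue A z.
Proof.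
rewrite eigenvalue_root_char /eigenvalues; case: closed_field_poly_normal => s /=.
by rewrite (monicP (char_poly_monic A)) scale1r => ->; rewrite root_prod_XsubC.
Qed.

Lemma spectral_radius_norm A z :
  z \in eigenvalues A -> `|z| <= spectral_radius A.
Proof.
have real_max (s : seq C) : \big[Num.max/0]_(x <- s) `|x| \is Num.real.
  by elim/big_rec: _ => [|x y _ yr]; rewrite ?real0 // max_real ?normr_real.
rewrite /spectral_radius; elim: (eigenvalues A) => // y s IHs.
rewrite inE big_cons comparable_le_max ?real_comparable ?normr_real //.
by case/predU1P => [->|/IHs ->]; rewrite ?lexx ?orbT.
Qed.

Lemma spectral_radius_attained A :
  (0 < n)%N -> exists2 z, z \in eigenvalues A & spectral_radius A = `|z|.
Proof.
move=> n_gt0.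
have: eigenvalues A != [::].
  rewrite /eigenvalues; case: closed_field_poly_normal => s /= As.
  apply/eqP => s0; move: (size_char_poly A).
  rewrite As s0 big_nil (monicP (char_poly_monic A)) scale1r size_poly1.
  by move=> [n0]; rewrite -n0 in n_gt0.
rewrite /spectral_radius; elim: (eigenvalues A) => // y s IHs _.
rewrite big_cons; case: (altP (s =P [::])) => [->|/IHs[z zs ->]].
  exists y; rewrite ?mem_head // big_nil.
  by rewrite comparable_maxC ?real_comparable ?real0 ?normr_real ?max_r.
have [_|_] := comparable_leP (real_comparable (normr_real y) (normr_real z)).
- by exists z; rewrite // inE zs orbT.
- by exists y; rewrite // mem_head.
Qed.

(** In a unitary eigenbasis both sides are weighted sums of the squared moduli of the coordinates,
    and no eigenvalue exceeds the spectral radius. Equality kills every coordinate whose eigenvalue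
    is smaller. *)
Lemma rayleigh A u : A \is hermsymmx ->
  (u *m A *m u^t*) 0 0 <= spectral_radius A * (u *m u^t*) 0 0
  /\ ((u *m A *m u^t*) 0 0 = spectral_radius A * (u *m u^t*) 0 0 ->
      u *m A = spectral_radius A *: u).
Proof.
move=> hA; set P := spectralmx A; set d := spectral_diag A.
have Pu : P \is unitarymx := spectral_unitarymx A.
have PK : P^t* *m P = 1%:M by rewrite -invmx_unitary // mulVmx ?unitarymx_unit.
have KP : P *m P^t* = 1%:M by apply/unitarymxP.
have dr i : d 0 i \is Num.real.
  exact: (mxOverP (hermitian_spectral_diag_real hA)).
have Aeq : A = P^t* *m diag_mx d *m P.
  by rewrite -invmx_unitary //; apply/orthomx_spectralP/hermitian_normalmx.
pose y := u *m P^t*.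
have uE : u = y *m P by rewrite /y -mulmxA PK mulmx1.
have utE : u^t* = P^t* *m y^t* by rewrite {1}uE trmx_mul map_mxM.
have d_le i : d 0 i <= spectral_radius A.
  apply: le_trans (real_ler_norm (dr i)) (spectral_radius_norm _).
  rewrite mem_eigenvalues; apply/eigenvalueP; exists (row i P).
    rewrite {1}Aeq !mulmxA -row_mul KP -[row i _ *m _]row_mul mul1mx.
    by rewrite row_diag_mx -scalemxAl -rowE.
  apply/eqP => Pi0; have /row_unitarymxP/(_ i i) := Pu.
  by rewrite dotmxE Pi0 eqxx mul0mx mxE => /eqP; rewrite eq_sym oner_eq0.
have norm_y : (u *m u^t*) 0 0 = \sum_i `|y 0 i| ^+ 2.
  rewrite utE mulmxA -/y mxE; apply: eq_bigr => i _.
  by rewrite !mxE -normCK.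
have form_y : (u *m A *m u^t*) 0 0 = \sum_i d 0 i * `|y 0 i| ^+ 2.
  rewrite {1}Aeq utE !mulmxA -/y -(mulmxA _ P) KP mulmx1 mxE.
  by apply: eq_bigr => i _; rewrite mul_mx_diag !mxE mulrAC normCK mulrC.
rewrite norm_y form_y mulr_sumr; split=> [|eq_yd].
  by apply: ler_sum => i _; rewrite ler_wpM2r ?exprn_ge0.
have: \sum_i (spectral_radius A - d 0 i) * `|y 0 i| ^+ 2 = 0.
  under eq_bigr do rewrite mulrBl.
  by rewrite sumrB -eq_yd subrr.
move/psumr_eq0P => yd0.
rewrite {1}Aeq !mulmxA -/y uE scalemxAl; congr (_ *m _).
apply/rowP => i; rewrite mul_mx_diag mxE [RHS]mxE.
have /eqP : (spectral_radius A - d 0 i) * `|y 0 i| ^+ 2 = 0.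
  by apply: yd0 => // j _; rewrite mulr_ge0 ?exprn_ge0 ?subr_ge0.
rewrite mulf_eq0 expf_eq0 /= normr_eq0 subr_eq0.
by case/orP => /eqP->; rewrite ?mulr0 ?mul0r // mulrC.
Qed.

End SpectralRadius.

Section PerronFrobenius.
Variables (C : numClosedFieldType) (n : nat) (A : 'M[C]_n).
Hypotheses (A_ge0 : forall i j, 0 <= A i j) (A_sym : forall i j, A i j = A j i).
Local Open Scope sesquilinear_scope.

Lemma nonneg_sym_hermsymmx : A \is hermsymmx.
Proof.
apply: realsym_hermsym.
  apply/is_hermitianmxP; rewrite expr0 scale1r map_mx_id //.
  by apply/matrixP => i j; rewrite mxE.
by apply/mxOverP => i j; apply: ger0_real.
Qed.

(** Replace the entries of an eigenvector of extremal modulus by their absolute values: by the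
    triangle inequality the Rayleigh quotient reaches the spectral radius, and the equality case of
    [rayleigh] applies. *)
Lemma nonneg_sym_perron : (0 < n)%N ->
  exists2 u : 'rV[C]_n, (forall i, 0 <= u 0 i) /\ u != 0
    & u *m A = spectral_radius A *: u.
Proof.
move=> /(@spectral_radius_attained C n A)[z].
rewrite mem_eigenvalues => /eigenvalueP[u uA u0] rho_z.
pose a : 'rV[C]_n := \row_i `|u 0 i|.
have a_ge0 i : 0 <= a 0 i by rewrite mxE.
have aE : a^t* = a^T.
  by apply/matrixP => i j; rewrite !mxE geC0_conj.
have [form_le form_eq] := rayleigh a nonneg_sym_hermsymmx.
exists a; first split=> //.
  apply: contraNneq u0 => a0; apply/eqP/rowP => i.
  by apply/eqP; rewrite mxE -normr_eq0; have /rowP/(_ i) := a0; rewrite !mxE => ->.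
apply/form_eq/eqP; rewrite eq_le form_le /= aE !mxE mulr_sumr.
apply: ler_sum => j _; rewrite mulrA ![a^T _ _]mxE ler_wpM2r //.
rewrite rho_z ![a _ _]mxE -normrM.
have /rowP/(_ j) := uA; rewrite [RHS]mxE => <-; rewrite !mxE.
apply: le_trans (ler_norm_sum _ _ _) _.
by apply: ler_sum => i _; rewrite normrM !mxE [`|A i j|]ger0_norm.
Qed.

Lemma nonneg_sym_rayleigh (u : 'rV[C]_n) : (forall i, u 0 i \is Num.real) ->
  \sum_j \sum_i u 0 i * A i j * u 0 j
    <= spectral_radius A * \sum_i u 0 i ^+ 2.
Proof.
move=> ur; have [+ _] := rayleigh u nonneg_sym_hermsymmx.
have -> : u^t* = u^T.
  by apply/matrixP => i j; rewrite !mxE (ord1 j) conj_Creal ?mxE.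
have -> : (u *m u^T) 0 0 = \sum_i u 0 i ^+ 2.
  by rewrite mxE; apply: eq_bigr => i _; rewrite mxE.
suff -> : (u *m A *m u^T) 0 0 = \sum_j \sum_i u 0 i * A i j * u 0 j by [].
by rewrite mxE; apply: eq_bigr => j _; rewrite !mxE mulr_suml.
Qed.

End PerronFrobenius.

(* [mu] is the largest eigenvalue of the 0/1 adjacency matrix, [m - 1] times
   the adjacency matrix of the paper. *)
Definition top_eigenvalue (F : realFieldType) (H : hypergraph) (mu : F) : Prop :=
  (exists2 x : H -> F, (forall y, 0 <= x y) /\ (exists y, x y != 0)
     & forall y, \sum_(y' | adjacent y y') x y' = mu * x y)
  /\ forall z : H -> F,
       \sum_y \sum_(y' | adjacent y y') z y * z y' <= mu * \sum_y z y ^+ 2.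

Lemma adjacent_sym (H : hypergraph) (x y : H) : adjacent x y = adjacent y x.
Proof.
rewrite /adjacent eq_sym; congr (_ && _).
by apply: eq_existsb => e; rewrite (andbC (x \in e)).
Qed.

Lemma lambda1_top_eigenvalue (C : numClosedFieldType) (m : nat) (H : hypergraph) :
  (2 <= m)%N -> (0 < #|H|)%N ->
  exists2 mu : creal C, creal_val mu = (m - 1)%:R * lambda1 C m H
    & top_eigenvalue H mu.
Proof.
move=> m2 H0; have n_gt0 : 0 < (m - 1)%:R :> C by rewrite ltr0n subn_gt0.
set A := adjmx C m H.
have A_ge0 i j : 0 <= A i j by rewrite mxE; case: ifP => // _; rewrite invr_ge0 ltW.
have A_sym i j : A i j = A j i by rewrite !mxE adjacent_sym.
have rho_real : (m - 1)%:R * lambda1 C m H \is Num.real.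
  have [z _ rho] := spectral_radius_attained A H0.
  by rewrite /lambda1 rho realM ?normr_real ?ger0_real ?ltW.
exists (CReal rho_real) => //.
pose rk (y : H) : 'I_#|H| := enum_rank y.
have rk_bij : {on [pred i | xpredT i], bijective rk}.
  exact/onW_bij/enum_rank_bij.
have AE (y y' : H) : A (rk y) (rk y') = (adjacent y y')%:R / (m - 1)%:R.
  by rewrite mxE !enum_rankK; case: ifP; rewrite ?mul0r ?mul1r.
split; last first.
  move=> z; pose u : 'rV[C]_#|H| := \row_i creal_val (z (enum_val i)).
  have ur i : u 0 i \is Num.real by rewrite mxE; case: (z _).
  have := nonneg_sym_rayleigh A_ge0 A_sym ur.
  rewrite -(ler_pM2l n_gt0) mulrA => le.
  change (creal_val (\sum_y \sum_(y' | adjacent y y') z y * z y')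
    <= creal_val (CReal rho_real * \sum_y z y ^+ 2)).
  rewrite rmorphM !rmorph_sum /=.
  apply: le_trans (le_trans _ le) _; last first.
    rewrite le_eqVlt; apply/orP; left; apply/eqP; congr (_ * _).
    rewrite (reindex rk rk_bij) /=; apply: eq_bigr => y _.
    by rewrite mxE enum_rankK rmorphXn.
  rewrite le_eqVlt; apply/orP; left; apply/eqP.
  rewrite mulr_sumr (reindex rk rk_bij) /=; apply: eq_bigr => y _.
  rewrite rmorph_sum mulr_sumr (reindex rk rk_bij) /= big_mkcond /=.
  apply: eq_bigr => y' _; rewrite AE !mxE !enum_rankK adjacent_sym.
  case: (adjacent y' y); last by rewrite !(mul0r, mulr0).
  by rewrite mul1r mulrAC mulrCA divff ?gt_eqF // mulr1 mulrC.
have [u [u_ge0 u0] uA] := nonneg_sym_perron A_ge0 A_sym H0.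
exists (fun y => CReal (ger0_real (u_ge0 (rk y)))); first split.
- by move=> y; apply: u_ge0.
- case/rV0Pn: u0 => i ui; exists (enum_val i).
  by rewrite -(inj_eq val_inj) /= /rk enum_valK.
move=> y; apply: val_inj; rewrite [RHS]rmorphM !rmorph_sum /=.
have /rowP/(_ (rk y)) := uA; rewrite [RHS]mxE -mulrA => <-; rewrite mxE mulr_sumr.
rewrite [RHS](reindex rk rk_bij) /= big_mkcond /=.
apply: eq_bigr => y' _; rewrite AE adjacent_sym.
case: (adjacent y' y); last by rewrite !(mul0r, mulr0).
by rewrite mul1r mulrCA divff ?gt_eqF // mulr1.
Qed.

(** * Rayleigh quotients *)

Section LinearHypergraph.
Variables (F : realFieldType) (H : hypergraph).
Hypothesis linH : linear_hypergraph H.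

(** By linearity an adjacent pair lies in exactly one edge, so no neighbour is counted twice. *)
Lemma sum_adjacent (g : H -> F) y :
  \sum_(y' | adjacent y y') g y' =
  \sum_(e in hedges H | y \in e) (\sum_(y' in e) g y' - g y).
Proof.
transitivity (\sum_(e in hedges H | y \in e) \sum_(y' in e | y' != y) g y'); last first.
  by apply: eq_bigr => e /andP[_ ye]; rewrite [in RHS](bigD1 y) //= addrAC subrr add0r.
rewrite (exchange_big_dep (fun y' => adjacent y y')) /=; last first.
  move=> e y' /andP[eH ye] /andP[y'e ne]; rewrite /adjacent eq_sym ne.
  by apply/exists_inP; exists e; rewrite // ye.
apply: eq_bigr => y' /andP[ne /exists_inP[e eH /andP[ye y'e]]].
rewrite (big_pred1 e) // => e' /=; rewrite eq_sym in ne.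
apply/andP/eqP => [[/andP[e'H ye'] /andP[y'e' _]]|->]; last by rewrite eH ye y'e ne.
apply/eqP; apply: contraTT isT => ee'.
have := linH e'H eH ee'; rewrite leqNgt; apply: contraNN => _.
by apply/card_gt1P; exists y', y; rewrite !inE ye ye' y'e y'e' ne.
Qed.

(** As the form splits over the edges, altering one edge affects a single term. *)
Lemma sum_adjacent_square (z : H -> F) :
  \sum_y \sum_(y' | adjacent y y') z y * z y' =
  \sum_(e in hedges H) ((\sum_(y in e) z y) ^+ 2 - \sum_(y in e) z y ^+ 2).
Proof.
transitivity (\sum_y \sum_(e in hedges H | y \in e) z y * (\sum_(y' in e) z y' - z y)).
  by apply: eq_bigr => y _; rewrite -mulr_sumr sum_adjacent mulr_sumr.
rewrite (exchange_big_dep (mem (hedges H))) /=; last by move=> y e _ /andP[].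
apply: eq_bigr => e eH.
rewrite (eq_bigl (mem e)); last by move=> y /=; rewrite eH.
under eq_bigr do rewrite mulrBr.
by rewrite sumrB -mulr_suml expr2; congr (_ - _); apply: eq_bigr => y _; rewrite expr2.
Qed.

End LinearHypergraph.

Lemma adjacent_iso (H K : hypergraph) (f : H -> K) : bijective f ->
    (forall e : {set H}, (f @: e \in hedges K) = (e \in hedges H)) ->
  forall y y', adjacent (f y) (f y') = adjacent y y'.
Proof.
move=> [g fK gK] fE y y'; rewrite /adjacent (can_eq fK); congr (_ && _).
apply/exists_inP/exists_inP => -[e eH]; last first.
  by move=> /andP[ye y'e]; exists (f @: e); rewrite ?fE // !imset_f.
have eg : e = f @: (g @: e).
  by rewrite -imset_comp -[LHS]imset_id; apply: eq_imset => z /=; rewrite gK.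
rewrite eg !(mem_imset _ _ (can_inj fK)) => ?; exists (g @: e) => //.
by rewrite -fE -eg.
Qed.

Section TopEigenvalue.
Variables (F : realFieldType) (H : hypergraph) (mu : F).
Hypothesis topH : top_eigenvalue H mu.

Lemma top_eigenvalue_ge0 : 0 <= mu.
Proof.
have [[x [x_ge0 [y y0]] xE] _] := topH.
have xy : 0 < x y by rewrite lt_def y0 x_ge0.
by rewrite -(pmulr_lge0 _ xy) -xE; apply: sumr_ge0.
Qed.

(** A zero weight forces zero weights on all neighbours, and so everywhere by connectedness. *)
Lemma top_eigenvalue_pos : connected_hypergraph H ->
  exists2 x : H -> F, forall y, 0 < x y
    & forall y, \sum_(y' | adjacent y y') x y' = mu * x y.
Proof.
move=> con; have [[x [x_ge0 [y0 xy0]] xE] _] := topH.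
exists x => // y; rewrite lt_def x_ge0 andbT.
apply: contra_neq xy0 => xy; have /connectP[p + ->] := con y y0.
elim: p y xy => //= y' p IHp y xy /andP[yy' pth]; apply: (IHp y') => //.
have := xE y; rewrite xy mulr0 => /psumr_eq0P; apply=> // ? _; exact: x_ge0.
Qed.

Lemma top_eigenvalue_hiso K (mu' : F) : hiso H K -> top_eigenvalue K mu' -> mu <= mu'.
Proof.
move=> [f f_bij fE] [_ topK]; have [[x [x_ge0 [y0 xy0]] xE] _] := topH.
have adjE := adjacent_iso f_bij fE; have [g fK gK] := f_bij.
have := topK (x \o g).
have f_onbij : {on [pred i | xpredT i], bijective f} by apply: onW_bij.
rewrite (reindex f f_onbij) [X in _ <= _ * X](reindex f f_onbij) /=.
under eq_bigr => y _.
  rewrite (reindex f) /=; last exact: onW_bij.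
  under eq_bigr do rewrite !fK.
  under eq_bigl do rewrite adjE.
  rewrite -mulr_sumr xE mulrCA -expr2.
  over.
under [X in _ <= _ * X]eq_bigr do rewrite fK.
rewrite -mulr_sumr ler_pM2r //.
rewrite lt_def sumr_ge0 ?andbT => [|y _]; last exact: exprn_ge0.
apply: contra_neq xy0 => /psumr_eq0P sq0.
by apply/eqP; rewrite -sqrf_eq0; apply/eqP/sq0 => // y _; apply: exprn_ge0.
Qed.

End TopEigenvalue.

Section StarBound.
Variables (F : realFieldType) (m : nat) (K : hypergraph) (mu w : F) (y0 : K).
Hypotheses (linK : linear_hypergraph K) (unifK : uniform m K).
Hypothesis topK : top_eigenvalue K mu.

Let St := [set e in hedges K | y0 \in e].
Let n : F := (m - 1)%:R.

(* Rayleigh quotient of the Perron vector of the hyperstar centred at [y0],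
   extended by zero. *)
Lemma star_bound : 0 < w -> (w + n - 1) * w < #|St|%:R * n -> w + n - 1 < mu.
Proof.
move=> w0 wlt.
pose z y := if y == y0 then w else if [exists e in St, y \in e] then 1 else 0.
have z_ge0 y : 0 <= z y.
  by rewrite /z; case: ifP => _; [exact: ltW|case: ifP].
have zSt e y : e \in St -> y \in e -> y != y0 -> z y = 1.
  move=> eS ye ne; rewrite /z (negbTE ne) ifT //.
  by apply/exists_inP; exists e.
have card_e e : e \in St -> \sum_(y in e | y != y0) 1 = n.
  rewrite inE => /andP[eK y0e]; rewrite sumr_const /n -(unifK eK) (cardsD1 y0) y0e addKn.
  by congr (_%:R); apply: eq_card => y; rewrite !inE andbC.
have n_ge0 : 0 <= n by apply: ler0n.
have sumSt e : e \in St ->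
    (\sum_(y in e) z y) ^+ 2 - \sum_(y in e) z y ^+ 2 = 2 * w * n + n ^+ 2 - n.
  move=> eS; have y0e : y0 \in e by move: eS; rewrite inE => /andP[].
  rewrite !(bigD1 y0 y0e) /= {1 3}/z eqxx.
  rewrite (eq_bigr (fun=> 1)); last by move=> y /andP[ye ne]; rewrite (zSt e).
  rewrite [X in _ - (_ + X)](eq_bigr (fun=> 1)); last first.
    by move=> y /andP[ye ne]; rewrite (zSt e) // expr1n.
  rewrite card_e //; ring.
have [_ /(_ z)] := topK; rewrite sum_adjacent_square // => Qle.
have Qge : #|St|%:R * (2 * w * n + n ^+ 2 - n) <= mu * \sum_y z y ^+ 2.
  apply: le_trans Qle; rewrite (big_setID St) /=.
  rewrite (_ : hedges K :&: St = St); last first.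
    by apply/setP => e; rewrite !inE andbA andbb.
  rewrite (eq_bigr _ sumSt) sumr_const mulr_natl lerDl; apply: sumr_ge0 => e _.
  rewrite subr_ge0 expr2 mulr_suml; apply: ler_sum => y ye.
  by rewrite expr2 ler_wpM2l // (bigD1 y) //= lerDl sumr_ge0.
have Zle : \sum_y z y ^+ 2 <= w ^+ 2 + #|St|%:R * n.
  rewrite (bigD1 y0) //= {1}/z eqxx lerD2l.
  have -> : #|St|%:R * n = \sum_(e in St) \sum_(y in e | y != y0) 1.
    by rewrite (eq_bigr _ card_e) sumr_const mulr_natl.
  rewrite (exchange_big_dep (fun y => y != y0)) /=; last by move=> e y _ /andP[].
  apply: ler_sum => y ne; rewrite /z (negbTE ne); case: exists_inP => [[e eS ye]|_].
    by rewrite expr1n (bigD1 e) /= ?eS ?ye ?ne // lerDl sumr_ge0.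
  by rewrite expr0n sumr_ge0.
(* Otherwise the quotient is bounded by w + n - 1; since (w + n - 1) w^2 < w d n by hypothesis, with
   d the size of [St], the norm bound falls below [Qge]. *)
rewrite ltNge; apply/negP => mu_le.
have mu0 := top_eigenvalue_ge0 topK.
have h1 := ler_wpM2l mu0 Zle.
have h2 : mu * (w ^+ 2 + #|St|%:R * n) <= (w + n - 1) * (w ^+ 2 + #|St|%:R * n).
  by rewrite ler_wpM2r // addr_ge0 ?exprn_ge0 ?mulr_ge0 // ltW.
have h3 : w * ((w + n - 1) * w) < w * (#|St|%:R * n) by rewrite ltr_pM2l.
move: (le_trans Qge (le_trans h1 h2)); lra.
Qed.

End StarBound.

(* Moving an edge attached at [a] to a vertex of larger Perron weight increases
   the Rayleigh quotient. *)
Lemma attach_move (F : realFieldType) m (K : hypergraph) (a b : K)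
    (Ka := attach m (fun _ : unit => a)) (Kb := attach m (fun _ : unit => b))
    (x : Ka -> F) (mu mu' : F) : (2 <= m)%N -> linear_hypergraph K ->
    (forall y, 0 < x y) -> (forall y, \sum_(y' | adjacent y y') x y' = mu * x y) ->
    top_eigenvalue Kb mu' -> x (inl a) < x (inl b) ->
  mu < mu'.
Proof.
move=> m2 linK x_gt0 xE [_ /(_ x) top] xab.
have t : 'I_(m - 1) by apply: Ordinal (_ : 0 < _)%N; rewrite subn_gt0.
have X0 : 0 < \sum_y x y ^+ 2.
  rewrite (bigD1 (inl a)) //= ltr_pwDl ?exprn_gt0 // sumr_ge0 // => y _.
  by rewrite exprn_ge0 // ltW.
rewrite -(ltr_pM2r X0); apply: lt_le_trans top.
have -> : mu * \sum_y x y ^+ 2 = \sum_y \sum_(y' | adjacent y y') x y * x y'.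
  rewrite mulr_sumr; apply: eq_bigr => y _.
  by rewrite -mulr_sumr xE expr2 mulrCA.
rewrite !sum_adjacent_square; [|exact: attach_linear|exact: attach_linear].
have sum_unit (g : unit -> F) : \sum_i g i = g tt by apply: big_pred1; case.
rewrite !attach_hedges_sum // ltrD2l !sum_unit.
pose R := \sum_(y in [set (inr (tt, s) : Ka) | s : 'I_(m - 1)]) x y.
pose R2 := \sum_(y in [set (inr (tt, s) : Ka) | s : 'I_(m - 1)]) x y ^+ 2.
have edge_sum (v : K) (g : Ka -> F) :
    \sum_(y in attach_edge m (fun _ : unit => v) tt) g y =
    g (inl v) + \sum_(y in [set (inr (tt, s) : Ka) | s : 'I_(m - 1)]) g y.
  rewrite /attach_edge big_setU1 //.
  by apply/imsetP => -[].
rewrite !edge_sum -/R -/R2.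
have R0 : 0 < R.
  have tR : (inr (tt, t) : Ka) \in [set (inr (tt, s) : Ka) | s : 'I_(m - 1)].
    by apply/imsetP; exists t.
  by rewrite /R (bigD1 _ tR) /= ltr_pwDl // sumr_ge0 // => y _; apply: ltW.
have : 0 < R * (x (inl b) - x (inl a)) by rewrite mulr_gt0 // subr_gt0.
lra.
Qed.

(** * Numerical inequalities *)

(* In the three [numeric_core] lemmas [S] is the number of edges off the cycle
   that avoid the maximal vertex [u], whose weight is normalised to 1, and [b]
   is the largest weight of another vertex. *)
Section Numeric.
Variables (F : realFieldType) (w r : F).
Hypotheses (w_gt0 : 0 < w) (r_ge0 : 0 <= r) (r_le1 : r <= 1).
Hypothesis w_quad : 18 - 12 * r + 5 * r * w <= w ^+ 2.

(** A line in r lying just below the positive root of t^2 - 5 r t - 18 + 12 r. They come closest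
    near r = 6 / 25, the source of the square in the proof. *)
Lemma w_lower : 21 / 5 + 27 / 20 * r <= w.
Proof.
move: w_gt0 r_ge0 r_le1 w_quad => w0 r0 r1 wq.
rewrite leNgt; apply/negP => w_lt.
set a := 21 / 5 + 27 / 20 * r in w_lt.
have fa : a ^+ 2 - 5 * r * a - 18 + 12 * r < 0.
  by rewrite /a; have := sqr_ge0 (r - 6 / 25); nra.
have a0 : 0 < a by rewrite /a; lra.
have : a * (w ^+ 2 - 5 * r * w - 18 + 12 * r) < 0.
  have -> : a * (w ^+ 2 - 5 * r * w - 18 + 12 * r)
    = w * (a ^+ 2 - 5 * r * a - 18 + 12 * r) - (a - w) * (18 - 12 * r)
      - a * w * (a - w) by ring.
  have h1 : w * (a ^+ 2 - 5 * r * a - 18 + 12 * r) < 0 by rewrite pmulr_rlt0.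
  have h2 : 0 < (a - w) * (18 - 12 * r) by rewrite mulr_gt0 //; lra.
  have h3 : 0 < a * w * (a - w) by rewrite !mulr_gt0 //; lra.
  lra.
rewrite pmulr_rlt0 //; lra.
Qed.

Lemma numeric_core_far (S : F) : 4 <= S ->
  (2 + 2 * r + r * S) * w + (1 + r) * S < (S - 1) * (1 + r * w) * w.
Proof.
move: w_gt0 r_ge0 r_le1 w_quad => w0 r0 r1 wq.
move=> S4; have wl := w_lower.
have h1 : 0 <= r * (S - 1) * w * (w - 21 / 5) by rewrite !mulr_ge0 //; lra.
have h2 : 0 <= (w - 21/5) * (S - 3) by rewrite mulr_ge0 //; lra.
have h3 : 0 <= r * (w - 21/5) * (16/5 * S - 31/5) by rewrite !mulr_ge0 //; lra.
have h4 : 0 <= r * (S - 4) by rewrite mulr_ge0 //; lra.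
nra.
Qed.

Lemma numeric_core2 (b : F) : 0 < b -> b <= 1 ->
  w ^+ 2 * b <= w + w * b + 3 * r * w * b + 2 * (1 + r) * b ->
  b * ((2 + 4 * r) * w + 2 * (1 + r)) < (1 + r * w) * w.
Proof.
move: w_gt0 r_ge0 r_le1 w_quad => w0 r0 r1 wq.
move=> b0 b1 hb; have wl := w_lower.
pose D := w ^+ 2 - w - 3 * r * w - 2 - 2 * r.
(* This bounds b by w / D, so it suffices to compare the coefficient of b with (1 + r w) D. *)
have bD : b * D <= w by rewrite /D; lra.
have key : (2 + 4 * r) * w + 2 * (1 + r) < (1 + r * w) * D.
  (* Up to 1/2, D is bounded below through [w_lower]; beyond, 2 r - 1 is positive and [w_quad] is
     used directly. The value of [w_lower] at r = 1/2 is 39/8. *)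
  case: (lerP r (1/2)) => r2.
    have D1 : w * (16 / 5 - 33 / 20 * r) - 2 - 2 * r <= D.
      have : 0 <= w * (w - (21 / 5 + 27 / 20 * r)) by rewrite mulr_ge0 //; lra.
      by rewrite /D; lra.
    apply: lt_le_trans (ler_wpM2l _ D1); last by nra.
    have h1 : 0 <= r * w * (w - 21 / 5) * (16 / 5 - 33 / 20 * r).
      by rewrite !mulr_ge0 //; lra.
    have h2 : 0 <= w * r * (1 / 2 - r) by rewrite !mulr_ge0 //; lra.
    have h3 : 0 <= r * (w - 21 / 5) by rewrite mulr_ge0 //; lra.
    lra.
  have D1 : 16 - 14 * r + (2 * r - 1) * w <= D by rewrite /D; lra.
  apply: lt_le_trans (ler_wpM2l _ D1); last by nra.
  have h1 : 0 <= r * (2 * r - 1) * w * (w - 39 / 8) by rewrite !mulr_ge0 //; lra.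
  have h2 : 0 <= w * (1 - r) * (r - 1 / 2) by rewrite !mulr_ge0 //; lra.
  have h3 : 0 <= (r - 1 / 2) * (w - 39 / 8) by rewrite mulr_ge0 //; lra.
  lra.
have D0 : 0 < D.
  have : 0 < (1 + r * w) * D by apply: le_lt_trans key; nra.
  by rewrite pmulr_rgt0 //; nra.
rewrite -(ltr_pM2r D0) mulrAC.
apply: le_lt_trans (_ : w * ((2 + 4 * r) * w + 2 * (1 + r)) < _).
  by rewrite ler_wpM2r //; nra.
by rewrite mulrAC [X in _ < X]mulrC ltr_pM2l.
Qed.

Lemma numeric_core3 (b : F) : 0 < b -> b <= 1 ->
  w ^+ 2 * b <= w + w * b + 4 * r * w * b + 3 * (1 + r) * b ->
  b * ((2 + 5 * r) * w + 3 * (1 + r)) < 2 * (1 + r * w) * w.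
Proof.
move: w_gt0 r_ge0 r_le1 w_quad => w0 r0 r1 wq.
move=> b0 b1 hb; have wl := w_lower.
(* From r = 1/4 on, where [w_lower] gives 363/80, the bound b <= 1 is enough. *)
case: (lerP (1/4) r) => r4.
  have key : (2 + 5 * r) * w + 3 * (1 + r) < 2 * (1 + r * w) * w.
    have h1 : 0 <= r * w * (w - 363 / 80) by rewrite !mulr_ge0 //; lra.
    have h2 : 0 <= r * (w - 363 / 80) by rewrite mulr_ge0 //; lra.
    lra.
  apply: le_lt_trans key; rewrite ler_piMl //; nra.
pose D := w ^+ 2 - w - 4 * r * w - 3 - 3 * r.
have bD : b * D <= w by rewrite /D; lra.
have key : (2 + 5 * r) * w + 3 * (1 + r) < 2 * (1 + r * w) * D.
  have D1 : w * (16 / 5 - 53 / 20 * r) - 3 - 3 * r <= D.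
    have : 0 <= w * (w - (21 / 5 + 27 / 20 * r)) by rewrite mulr_ge0 //; lra.
    by rewrite /D; lra.
  apply: lt_le_trans (ler_wpM2l _ D1); last by nra.
  have h1 : 0 <= r * w * (w - 21 / 5) * (16 / 5 - 53 / 20 * r).
    by rewrite !mulr_ge0 //; lra.
  have h2 : 0 <= w * r * (1 / 4 - r) by rewrite !mulr_ge0 //; lra.
  have h3 : 0 <= r * (w - 21 / 5) by rewrite mulr_ge0 //; lra.
  lra.
have D0 : 0 < D.
  have : 0 < 2 * (1 + r * w) * D by apply: le_lt_trans key; nra.
  by rewrite pmulr_rgt0 //; nra.
rewrite -(ltr_pM2r D0) mulrAC.
apply: le_lt_trans (_ : w * ((2 + 5 * r) * w + 3 * (1 + r)) < _).
  by rewrite ler_wpM2r //; nra.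
by rewrite mulrAC [X in _ < X]mulrC ltr_pM2l.
Qed.

Lemma numeric_tree (S : F) : 1 <= S ->
  (2 * r + r * (S - 1)) * w + 4 + 2 * r + (1 + r) * (S - 1) < S * (1 + r * w) * w.
Proof.
move: w_gt0 r_ge0 r_le1 w_quad => w0 r0 r1 wq.
move=> S1; have wl := w_lower.
have h1 : 0 <= r * S * w * (w - 21 / 5) by rewrite !mulr_ge0 //; lra.
have h2 : 0 <= (w - 21/5) * S by rewrite mulr_ge0 //; lra.
have h3 : 0 <= r * (w - 21/5) * (16/5 * S - 1) by rewrite !mulr_ge0 //; lra.
have h4 : 0 <= r * (S - 1) by rewrite mulr_ge0 //; lra.
nra.
Qed.

(** Here y is the weight of the cycle vertex carrying the stray edge and b the largest weight apart
    from the maximum. Eliminating b leaves the inequality [key] in w and r. *)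
Lemma numeric_far_vertex (b y : F) : 0 < b ->
  (w - 1 - r) * b <= 1 -> (w ^+ 2 - 2 * r * w - 1) * y <= 2 * b * w -> w * y < 1.
Proof.
move: w_gt0 r_ge0 r_le1 w_quad => w0 r0 r1 wq.
move=> b0 hb hy; have wl := w_lower.
have key : 2 * w ^+ 2 < (w ^+ 2 - 2 * r * w - 1) * (w - 1 - r) by nra.
have w1 : 0 < w - 1 - r by lra.
have E0 : 0 < w ^+ 2 - 2 * r * w - 1.
  have : 0 < (w ^+ 2 - 2 * r * w - 1) * (w - 1 - r) by apply: le_lt_trans key; nra.
  by rewrite pmulr_lgt0.
rewrite ltNge; apply/negP => wy.
have h1 : w ^+ 2 - 2 * r * w - 1 <= (w ^+ 2 - 2 * r * w - 1) * y * w.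
  by rewrite -[leRHS]mulrA ler_peMr ?(ltW E0) // mulrC.
have h2 : w ^+ 2 - 2 * r * w - 1 <= 2 * b * w ^+ 2.
  apply: le_trans h1 _; have -> : 2 * b * w ^+ 2 = 2 * b * w * w by ring.
  exact: ler_wpM2r (ltW w0) _ _ hy.
have h3 : (w ^+ 2 - 2 * r * w - 1) * (w - 1 - r) <= 2 * b * w ^+ 2 * (w - 1 - r).
  by rewrite ler_wpM2r // ltW.
have h4 : 2 * b * w ^+ 2 * (w - 1 - r) <= 2 * w ^+ 2.
  have -> : 2 * b * w ^+ 2 * (w - 1 - r) = 2 * w ^+ 2 * ((w - 1 - r) * b) by ring.
  by rewrite ler_piMr // mulr_ge0 ?exprn_ge0 // ltW.
by have := lt_le_trans key (le_trans h3 h4); rewrite ltxx.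
Qed.

End Numeric.

(** * Estimates at a vertex of maximal Perron weight *)

Section PerronEstimates.
Variables (F : realFieldType) (l : nat) (N : finType) (par : N -> 'I_l + N).
Variables (rk : N -> nat) (x : 'I_l + N -> F) (w r : F).
Hypothesis l_gt2 : (2 < l)%N.
Hypothesis rkP : forall n n', par n = inr n' -> (rk n' < rk n)%N.
Hypotheses (w_gt0 : 0 < w) (r_ge0 : 0 <= r) (r_le1 : r <= 1).
Hypothesis x_gt0 : forall v, 0 < x v.

(** What the edges to children contribute to the equation at v. A tree vertex has deg - 1 children
    and a cycle vertex deg - 2, so all of r (deg - 1) x_v is absorbed except one r x_v in
    [core_eq]. *)
Definition kids (v : 'I_l + N) : F := \sum_(n | par n == v) (r * x v + x (inr n)).
Definition rcount (P : pred N) : F := \sum_(n | P n) 1.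
(** The children of the members of T; for T the children of u, the grandchildren of u. *)
Definition grand (T : pred N) : pred N :=
  fun n => if par n is inr n' then T n' else false.

Hypothesis core_eq : forall i,
  w * x (inl i) = r * x (inl i) + x (inl (ordS i)) + x (inl (ord_pred i)) + kids (inl i).
Hypothesis tree_eq : forall n, w * x (inr n) = x (par n) + kids (inr n).

Lemma count_ge0 P : 0 <= rcount P.
Proof. by apply: sumr_ge0. Qed.

Lemma le_count (P Q : pred N) : {subset P <= Q} -> rcount P <= rcount Q.
Proof.
move=> PQ; rewrite /rcount (big_mkcond P) (big_mkcond Q) /=.
apply: ler_sum => n _; case: ifP => [/PQ Qn|_]; last by case: ifP.
by rewrite ifT.
Qed.

Lemma count_disjoint (P1 P2 Q : pred N) :
  {subset P1 <= Q} -> {subset P2 <= Q} -> (forall n, P1 n -> P2 n -> False) ->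
  rcount P1 + rcount P2 <= rcount Q.
Proof.
move=> s1 s2 dis; rewrite /rcount (big_mkcond P1) (big_mkcond P2) (big_mkcond Q) /=.
rewrite -big_split; apply: ler_sum => n _ /=.
have := s1 n; have := s2 n; have := dis n; rewrite !unfold_in.
case: (P1 n); case: (P2 n); case: (Q n) => //.
- by move=> /(_ isT isT).
- by move=> /(_ isT isT).
- by move=> _ _; rewrite addr0.
- by move=> _ _ /(_ isT).
- by move=> _ _; rewrite add0r.
- by move=> _ /(_ isT).
- by rewrite addr0 ler01.
- by rewrite addr0.
Qed.

Lemma sum_grand (T : pred N) (f : N -> F) :
  \sum_(n | T n) \sum_(n' | par n' == inr n) f n' = \sum_(n' | grand T n') f n'.
Proof.
rewrite (exchange_big_dep (grand T)) /=; last first.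
  by move=> n n' Tn /eqP pn'; rewrite /grand pn'.
apply: eq_bigr => n; rewrite /grand; case E: (par n) => [//|n'] Tn'.
rewrite (big_pred1 n') // => n2 /=; apply/andP/eqP => [[_ /eqP[]]|->] //.
Qed.

Lemma tree_bound (b : F) n : x (par n) <= b -> x (inr n) <= b ->
    (forall n', par n' == inr n -> x (inr n') <= b) ->
  w * x (inr n) <= b * (1 + (1 + r) * rcount (fun n' => par n' == inr n)).
Proof.
move=> xp xn xc; rewrite tree_eq mulrDr mulr1 lerD //.
rewrite /kids /rcount mulr_sumr mulr_sumr; apply: ler_sum => n' pn'.
rewrite mulr1 mulrDr mulr1 addrC lerD ?xc // mulrC ler_wpM2r //.
Qed.

(** In the sum of the equations over T, each member of T costs b for its parent and each of its
    children (1 + r) b. Parents and children being disjoint within Q, every edge of Q is paid at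
    most once. *)
Lemma sum_tree_bound (b : F) (T Q : pred N) : 0 <= b ->
    (forall n, T n -> [/\ x (par n) <= b, x (inr n) <= b &
      forall n', par n' == inr n -> x (inr n') <= b]) ->
    {subset T <= Q} -> {subset grand T <= Q} -> (forall n, T n -> grand T n -> False) ->
  w * \sum_(n | T n) x (inr n) <= b * (1 + r) * rcount Q.
Proof.
move=> b0 Tb TQ gTQ dis.
apply: le_trans (_ : b * (rcount T + (1 + r) * rcount (grand T)) <= _).
  rewrite mulr_sumr [rcount (grand T)]/rcount -sum_grand mulr_sumr -big_split mulr_sumr.
  by apply: ler_sum => n /Tb[]; apply: tree_bound.
rewrite -mulrA ler_wpM2l //.
apply: le_trans (_ : (1 + r) * (rcount T + rcount (grand T)) <= _).
  by rewrite [leRHS]mulrDr lerD2r ler_peMl ?count_ge0 // lerDl.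
by rewrite ler_wpM2l ?addr_ge0 //; apply: count_disjoint.
Qed.

Lemma kids_split v : kids v = r * x v * rcount (fun n => par n == v)
  + \sum_(n | par n == v) x (inr n).
Proof.
rewrite /kids big_split /= /rcount mulr_sumr; congr (_ + _).
by apply: eq_bigr => *; rewrite mulr1.
Qed.

Hypothesis w_quad : 18 - 12 * r + 5 * r * w <= w ^+ 2.
Hypothesis w_star : r * #|N|%:R * w + #|N|%:R + 1 <= w ^+ 2.

Lemma count_predC (P : pred N) : rcount P + rcount (predC P) = #|N|%:R.
Proof.
rewrite /rcount -(bigID P xpredT (fun=> 1)) /= sumr_const.
by rewrite cardT -cardE.
Qed.

Section CoreMaximum.
Variable (i0 : 'I_l).
Let u : 'I_l + N := inl i0.
Hypotheses (xu : x u = 1) (x_le1 : forall v, x v <= 1).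

Let S := rcount (fun n => par n != u).
Let A := rcount (fun n => par n == u).

(** At the second largest vertex v at most one neighbour is u, because l > 2; the others weigh at
    most b. The children of v are then expanded once more. *)
Lemma core_second_bound (b : F) (v : 'I_l + N) : v != u -> x v = b ->
    (forall v', v' != u -> x v' <= b) ->
  w ^+ 2 * b <= w + w * b + (1 + S) * r * w * b + S * (1 + r) * b.
Proof.
move=> vu xv xb; have b0 : 0 < b by rewrite -xv.
have kb : w * kids v <= w * (r * b * S) + b * (1 + r) * S.
  rewrite kids_split mulrDr lerD //.
    rewrite ler_wpM2l ?(ltW w_gt0) // xv ler_wpM2l ?mulr_ge0 ?(ltW b0) //.
    by apply: le_count => n; rewrite !unfold_in => /eqP->.
  apply: sum_tree_bound; first exact: ltW.
  - move=> n /eqP pn; split; rewrite ?pn ?xv //; first by apply: xb.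
    by move=> n' _; apply: xb.
  - by move=> n; rewrite !unfold_in => /eqP ->.
  - by move=> n; rewrite !unfold_in /grand; case: (par n).
  - move=> n /eqP pn; rewrite /grand pn; case: (v) (pn) => // n0 pn0 /eqP pn0'.
    by have := parN rkP n0; rewrite pn0' eqxx.
have nb : w * b <= r * b + 1 + b + kids v.
  case: v vu xv kb => [j|n] vu xv _.
    rewrite -xv core_eq lerD2r -!addrA lerD2l.
    case: (eqVneq (ordS j) i0) => [Sj|Sj].
      rewrite lerD ?x_le1 // xv xb //; apply/eqP => -[pj].
      by have := ordS_ord_pred_neq j l_gt2; rewrite Sj pj eqxx.
    by rewrite addrC lerD ?x_le1 // xv xb.
  rewrite -xv tree_eq lerD2r; apply: le_trans (x_le1 _) _.
  have : 0 <= r * x (inr n) by rewrite mulr_ge0 // ltW.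
  by have := x_gt0 (inr n); lra.
have := ler_wpM2l (ltW w_gt0) nb.
by lra.
Qed.

(** Expanding the equation at u twice expresses w^2 through the ends of the 2-paths from u. Each
    edge at u is paid for by the star bound, so only the S other off-cycle edges remain to be
    compared. *)
Lemma core_maximum_count : S < 2.
Proof.
rewrite ltNge; apply/negP => S2.
have p_u : inl (ordS i0) != u.
  by apply/eqP => -[]; apply/eqP/ordS_neq/ltnW.
have m_u : inl (ord_pred i0) != u.
  by apply/eqP => -[]; apply/eqP/ord_pred_neq/ltnW.
have [v vu vmax] : exists2 v, v != u & forall v', v' != u -> x v' <= x v.
  have := @arg_maxP _ _ _ (inl (ordS i0) : 'I_l + N) (fun v => v != u) x p_u.
  by case=> v vu vmax; exists v.
set b := x v in vmax; have b0 : 0 < b by apply: x_gt0.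
have b1 : b <= 1 by apply: x_le1.
have second := @core_second_bound b v vu erefl vmax.
(* The ends of the 2-paths from u whose second step goes down an off-cycle edge. *)
pose T n := [|| par n == inl (ordS i0), par n == inl (ord_pred i0)
              | grand (fun n' => par n' == u) n].
have TQ : {subset T <= (fun n => par n != u)}.
  move=> n; rewrite !unfold_in /T => /or3P[/eqP->|/eqP->|] //.
  by rewrite /grand; case: (par n).
have sumT : w * \sum_(n | T n) x (inr n) <= b * (1 + r) * S.
  apply: sum_tree_bound => //; first exact: ltW.
  - move=> n Tn; split; last by move=> *; apply: vmax.
      by apply: vmax; apply: TQ.
    exact: vmax.
  - by move=> n; rewrite !unfold_in /grand; case: (par n).
  move=> n Tn; rewrite /grand; case E: (par n) Tn => [//|n'].
  rewrite /T E /grand E /= => /eqP pn'.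
  rewrite pn' !(inj_eq inl_inj).
  rewrite [_ == ordS _]eq_sym (negbTE (ordS_neq _ _)) 1?ltnW //.
  by rewrite [_ == ord_pred _]eq_sym (negbTE (ord_pred_neq _ _)) 1?ltnW.
have kidsT : kids (inl (ordS i0)) + kids (inl (ord_pred i0))
    + \sum_(n | par n == u) kids (inr n) <= r * b * S + \sum_(n | T n) x (inr n).
  rewrite {3}/kids (eq_bigr (fun n => \sum_(n' | par n' == inr n)
     (r * x (par n') + x (inr n')))); last first.
    by move=> n _; apply: eq_bigr => n' /eqP->.
  rewrite sum_grand /kids.
  rewrite (eq_bigr (fun n' => r * x (par n') + x (inr n'))); last by move=> ? /eqP->.
  rewrite [X in _ + X + _](eq_bigr (fun n' => r * x (par n') + x (inr n'))); last first.
    by move=> ? /eqP->.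
  have -> : forall f : N -> F, \sum_(n | par n == inl (ordS i0)) f n
      + \sum_(n | par n == inl (ord_pred i0)) f n
      + \sum_(n | grand (fun n' => par n' == u) n) f n = \sum_(n | T n) f n.
    move=> f; rewrite !(big_mkcond (fun n => par n == _)) /=.
    rewrite (big_mkcond (grand _)) (big_mkcond T) -!big_split; apply: eq_bigr => n _ /=.
    rewrite /T /grand; case: (par n) => [j|n'] /=; last by rewrite !add0r.
    rewrite addr0 !(inj_eq inl_inj); case: eqP => [->|_].
      by rewrite (negbTE (ordS_ord_pred_neq _ _)) // addr0.
    by rewrite add0r orbF.
  rewrite big_split /= lerD2r.
  apply: le_trans (_ : r * b * rcount T <= _).
    rewrite /rcount mulr_sumr; apply: ler_sum => n Tn; rewrite mulr1 ler_wpM2l //.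
    by apply: vmax; apply: TQ.
  by rewrite ler_wpM2l ?mulr_ge0 ?(ltW b0) //; apply: le_count.
have eu := core_eq i0; rewrite -/u xu !mulr1 kids_split xu mulr1 -/A in eu.
have ep := core_eq (ordS i0); rewrite ordSK -/u xu in ep.
have em := core_eq (ord_pred i0); rewrite ord_predK -/u xu in em.
have ec : w * \sum_(n | par n == u) x (inr n) = A + \sum_(n | par n == u) kids (inr n).
  rewrite mulr_sumr -big_split /=; apply: eq_bigr => n /eqP pn.
  by rewrite tree_eq pn xu.
have AS : A + S = #|N|%:R by apply: (count_predC (fun n => par n == u)).
have pp_b : x (inl (ordS (ordS i0))) <= b.
  by apply: vmax; apply/eqP => -[]; apply/eqP/ordSS_neq.
have mm_b : x (inl (ord_pred (ord_pred i0))) <= b.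
  apply: vmax; apply/eqP => -[/(congr1 (@ordS l))]; rewrite ord_predK.
  by move/eqP; rewrite eq_sym (negbTE (ordS_ord_pred_neq _ _)).
have rp_b : r * x (inl (ordS i0)) <= r * b by rewrite ler_wpM2l ?vmax.
have rm_b : r * x (inl (ord_pred i0)) <= r * b by rewrite ler_wpM2l ?vmax.
have w_star' := w_star; rewrite -AS in w_star'.
have main : (S - 1) * (1 + r * w) <= b * (2 + 2 * r + r * S) + \sum_(n | T n) x (inr n).
  have : w ^+ 2 = w * (r + x (inl (ordS i0)) + x (inl (ord_pred i0)) +
       (r * A + \sum_(n | par n == u) x (inr n))) by rewrite -eu -expr2.
  lra.
have {}main : (S - 1) * (1 + r * w) * w <= b * ((2 + 2 * r + r * S) * w + (1 + r) * S).
  have := ler_wpM2r (ltW w_gt0) main; lra.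
(* As S is an integer, 2 and 3 can be treated apart with the sharper bound on b; from 4 on, b <= 1
   suffices. *)
have [s Ss] : exists s : nat, S = s%:R.
  by eexists; rewrite /S /rcount sumr_const.
rewrite Ss in main second S2.
have {S2}: (2 <= s)%N by rewrite -(ler_nat F).
rewrite leq_eqVlt => /predU1P[s2|].
  rewrite -s2 in main second.
  have h : w ^+ 2 * b <= w + w * b + 3 * r * w * b + 2 * (1 + r) * b by lra.
  have := numeric_core2 w_gt0 r_ge0 r_le1 w_quad b0 b1 h.
  lra.
rewrite leq_eqVlt => /predU1P[s3|s4].
  rewrite -s3 in main second.
  have h : w ^+ 2 * b <= w + w * b + 4 * r * w * b + 3 * (1 + r) * b by lra.
  have := numeric_core3 w_gt0 r_ge0 r_le1 w_quad b0 b1 h.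
  lra.
have S4 : 4 <= s%:R :> F by rewrite (ler_nat F 4).
have := numeric_core_far w_gt0 r_ge0 r_le1 w_quad S4.
rewrite ltNge => /negP; apply; apply: le_trans main _.
rewrite ler_piMl // addr_ge0 // !mulr_ge0 ?addr_ge0 ?mulr_ge0 ?(ltW w_gt0) //.
Qed.

End CoreMaximum.

Section TreeMaximum.
Variable (n0 : N).
Let u : 'I_l + N := inr n0.
Hypotheses (xu : x u = 1) (x_le1 : forall v, x v <= 1).

Let S := rcount (fun n => par n != u).
Let A := rcount (fun n => par n == u).

Lemma tree_maximum_count_pos : 1 <= S.
Proof.
have -> : 1 = rcount (pred1 n0) by rewrite /rcount big_pred1_eq.
by apply: le_count => n; rewrite !unfold_in => /eqP->; apply: (parN rkP).
Qed.

(** For v the parent of u: the ends of the descending second steps from u, the return from v to u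
    being left out. *)
Let second (v : 'I_l + N) : pred N :=
  fun n => ((par n == v) && (n != n0)) || grand (fun n' => par n' == u) n.

Lemma tree_maximum_parent_kids (v : 'I_l + N) : par n0 = v ->
  kids v + \sum_(n | par n == u) kids (inr n)
    <= r * x v + 1 + r * rcount (second v) + \sum_(n | second v n) x (inr n).
Proof.
move=> pn0; set T := second v.
rewrite (eq_bigr (fun n => \sum_(n' | par n' == inr n)
   (r * x (par n') + x (inr n')))); last first.
  by move=> n _; apply: eq_bigr => n' /eqP->.
rewrite sum_grand /kids (bigD1 n0) ?pn0 //= -/u xu -!addrA lerD2l lerD2l.
rewrite (eq_bigr (fun n' => r * x (par n') + x (inr n'))); last by move=> ? /andP[/eqP->].
have -> : forall f : N -> F, \sum_(n | (par n == v) && (n != n0)) f n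
    + \sum_(n | grand (fun n' => par n' == u) n) f n = \sum_(n | T n) f n.
  move=> f; rewrite (big_mkcond (grand _)) (big_mkcond T).
  rewrite (big_mkcond (fun n => _ && _)) -big_split; apply: eq_bigr => n _ /=.
  rewrite /T /second /grand; case E: (par n) => [j|n'] /=.
    by rewrite addr0 orbF.
  case: ifP => [/andP[/eqP pn nn]|_]; last by rewrite add0r.
  rewrite ifF ?addr0 //; apply: contraTF nn => /eqP pn'; rewrite negbK.
  have E0 : par n0 = inr n' by rewrite pn0 -pn.
  by have := ltn_trans (rkP E0) (rkP pn'); rewrite ltnn.
rewrite big_split /= lerD2r /rcount mulr_sumr.
by apply: ler_sum => n _; rewrite mulr1 ler_piMr.
Qed.

Lemma tree_maximum_eq : w ^+ 2 =
  w * x (par n0) + r * A * w + A + \sum_(n | par n == u) kids (inr n).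
Proof.
have eu := tree_eq n0; rewrite -/u xu mulr1 kids_split xu mulr1 -/A in eu.
have ec : w * \sum_(n | par n == u) x (inr n) = A + \sum_(n | par n == u) kids (inr n).
  rewrite mulr_sumr -big_split /=; apply: eq_bigr => n /eqP pn.
  by rewrite tree_eq pn xu.
have -> : w ^+ 2 = w * (x (par n0) + (r * A + \sum_(n | par n == u) x (inr n))).
  by rewrite -eu expr2.
lra.
Qed.

(** A vertex off the cycle has a single upward edge, so its 2-paths are too light for the star
    bound. If the parent is off the cycle, two steps suffice; if it is on the cycle, its two cycle
    neighbours must be expanded once more. *)
Lemma tree_maximum_false : False.
Proof.
have S1 := tree_maximum_count_pos.
have w_star' := w_star.
have AS : A + S = #|N|%:R by apply: (count_predC (fun n => par n == u)).
rewrite -AS in w_star'.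
have wsq := tree_maximum_eq; have wl := w_lower w_gt0 r_ge0 r_le1 w_quad.
have n0u : par n0 != u := parN rkP n0.
case E: (par n0) => [p|n1]; have := tree_maximum_parent_kids E; last first.
  set T := second _ => kidsT.
  (* The edges above u and above its parent avoid the children of u and are not in T, which gains
     2. *)
  have TS : rcount T + rcount (pred2 n0 n1) <= S.
    apply: count_disjoint => n; rewrite ?unfold_in /T /second /grand.
    - case: eqP => [-> /= _|_ /=]; first by rewrite -E.
      case E2: (par n) => [//|n'] /eqP pn'.
      by apply/eqP => -[n'0]; rewrite n'0 -/u in pn'; rewrite pn' eqxx in n0u.
    - case/orP => /eqP-> //; apply/eqP => pn1.
      by have := ltn_trans (rkP E) (rkP pn1); rewrite ltnn.
    - move=> /orP Tn /orP[] /eqP nE; rewrite {}nE in Tn.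
        rewrite eqxx andbF E in Tn; case: Tn => // /eqP pn1.
        by have := ltn_trans (rkP E) (rkP pn1); rewrite ltnn.
      case: Tn => [/andP[/eqP /rkP]|]; first by rewrite ltnn.
      case E1: (par n1) => [//|n'] /eqP /rkP.
      by move=> n'0; have := ltn_trans (ltn_trans n'0 (rkP E1)) (rkP E); rewrite ltnn.
  have c2 : rcount (pred2 n0 n1) = 2.
    rewrite /rcount (bigD1 n0) /=; last by rewrite eqxx.
    rewrite (big_pred1 n1) // => n; rewrite /=; case: eqP => [->|_] /=.
      by apply/esym/eqP => n01; have := rkP E; rewrite -n01 ltnn.
    by rewrite andbT.
  rewrite c2 in TS.
  have sT : \sum_(n | T n) x (inr n) <= rcount T by apply: ler_sum.
  have en1 := tree_eq n1; rewrite E in wsq.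
  have x1 := x_le1 (par n1); have rx1 : r * x (inr n1) <= r * 1.
    by rewrite ler_wpM2l.
  have g1 : kids (inr n1) + \sum_(n | par n == u) kids (inr n) <=
    r * x (inr n1) + 1 + r * rcount T + rcount T.
    by move: kidsT sT; lra.
  have g2 : r * S * w + S + 1 <=
      x (par n1) + kids (inr n1) + \sum_(n | par n == u) kids (inr n).
    by move: w_star' wsq en1; lra.
  have h : S * (1 + r * w) <= (1 + r) * (1 + rcount T).
    by move: g1 g2 x1 rx1; lra.
  have h2 : (1 + r) * (1 + rcount T) <= (1 + r) * (S - 1).
    by rewrite ler_wpM2l ?addr_ge0 //; move: TS; lra.
  have h3 : 0 <= r * S * (w - 1) by rewrite !mulr_ge0 //; move: S1 wl r_ge0; lra.
  move: h h2 h3 S1 r_ge0; lra.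
set T := second _ => kidsT.
pose K n := (par n == inl (ordS p)) || (par n == inl (ord_pred p)).
pose TT n := T n || grand T n.
(* The third steps use edges disjoint from those already counted, and none of them is the edge above
   u, which gains 1. *)
have TTK : rcount TT + rcount K <= rcount (fun n => (par n != u) && (n != n0)).
  apply: count_disjoint => n; rewrite ?unfold_in /TT /T /second /K /grand.
  - case E2: (par n) => [j|n'] /=.
      by rewrite !orbF => /andP[_ ->].
    move=> H; have nn0 : n != n0 by apply: contraTneq isT => nE; rewrite nE E in E2.
    rewrite nn0 andbT; apply: contraTneq H => -[->]; rewrite -/u (negbTE n0u) E.
    by rewrite !eqxx.
  - have neq j : par n == inl j -> j != p -> (par n != u) && (n != n0).
      move=> /eqP pn jp; rewrite pn /=.
      by apply: contraNneq jp => nE; move: pn; rewrite nE E => -[->].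
    by case/orP=> pn; apply: (neq _ pn); [apply: ordS_neq|apply: ord_pred_neq]; apply: ltnW.
  - case E2: (par n) => [j|n'] //=; rewrite !orbF !(inj_eq inl_inj).
    by move=> /andP[/eqP-> _] /orP[]; rewrite eq_sym ?(negbTE (ordS_neq _ _))
      ?(negbTE (ord_pred_neq _ _)) // ltnW.
have S1E : rcount (fun n => (par n != u) && (n != n0)) = S - 1.
  by rewrite /S /rcount [in RHS](bigD1 n0) //= addrAC subrr add0r.
have sT : w * \sum_(n | T n) x (inr n) <= 1 * (1 + r) * rcount TT.
  apply: sum_tree_bound => //.
  - by move=> n Tn; apply/orP; left.
  - by move=> n Tn; apply/orP; right.
  move=> n; rewrite /T /second /grand; case E2: (par n) => [//|n'] /=.
  by move=> /eqP pn'; rewrite pn' /= (negbTE n0u).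
have cT : rcount T <= S - 1.
  apply: le_trans (_ : rcount TT <= _).
    by apply: le_count => n Tn; apply/orP; left.
  by rewrite -S1E; apply: le_trans TTK; rewrite lerDl count_ge0.
have sK : kids (inl (ordS p)) + kids (inl (ord_pred p)) <= (1 + r) * rcount K.
  rewrite /kids /rcount mulr_sumr.
  rewrite [leRHS](bigID (fun n => par n == inl (ordS p))) /= lerD //.
    rewrite [leRHS](eq_bigl (fun n => par n == inl (ordS p))).
      by apply: ler_sum => n _; rewrite mulr1 addrC lerD // ler_piMr.
    by move=> n; rewrite /K; case: (par n == inl (ordS p)); rewrite ?andbF.
  rewrite [leRHS](eq_bigl (fun n => par n == inl (ord_pred p))).
    by apply: ler_sum => n _; rewrite mulr1 addrC lerD // ler_piMr.
  move=> n; rewrite /K; case: eqP => [->|_] /=; last by rewrite andbT.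
  by rewrite (inj_eq inl_inj); apply/esym/negbTE/ordS_ord_pred_neq.
rewrite E in wsq.
have ep := core_eq p.
have eS := core_eq (ordS p); rewrite ordSK in eS.
have eP := core_eq (ord_pred p); rewrite ord_predK in eP.
have x1 := x_le1 (inl p); have x2 := x_le1 (inl (ordS (ordS p))).
have x3 := x_le1 (inl (ord_pred (ord_pred p))).
have le_r v : r * x v <= r by rewrite ler_piMr.
have r1 := le_r (inl p); have r2 := le_r (inl (ordS p)).
have r3 := le_r (inl (ord_pred p)).
have h1 : S * (1 + r * w) <= 2 * r + x (inl (ordS p)) + x (inl (ord_pred p))
   + r * rcount T + \sum_(n | T n) x (inr n) by lra.
have h2 : r * w * rcount T <= r * w * (S - 1).
  by rewrite ler_wpM2l ?mulr_ge0 // ltW.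
have h3 : (1 + r) * (rcount TT + rcount K) <= (1 + r) * (S - 1).
  by rewrite -S1E ler_wpM2l // addr_ge0.
have := ler_wpM2r (ltW w_gt0) h1.
have := numeric_tree w_gt0 r_ge0 r_le1 w_quad S1.
lra.
Qed.

End TreeMaximum.

Section FarVertex.
Variables (i0 j : 'I_l) (n1 q : N).
Let u : 'I_l + N := inl i0.
Hypotheses (xu : x u = 1) (x_le1 : forall v, x v <= 1).
Hypotheses (par1 : par n1 = inl j) (parE : forall n, n != n1 -> par n = u).
Hypotheses (ji : j != i0) (jS : j != ordS i0) (jP : j != ord_pred i0).
Hypothesis par_q : par q = u.

(** A leaf at u has weight 1 / w. The vertex j sees u only through its two cycle neighbours, and
    each of these weighs at most about 1 / (w - 1 - r). *)
Lemma far_vertex_small : x (inl j) < x (inr q).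
Proof.
have wl := w_lower w_gt0 r_ge0 r_le1 w_quad.
have kids_tree n : kids (inr n) = 0.
  rewrite /kids big_pred0 // => n'; apply/negbTE.
  by case: (eqVneq n' n1) => [->|/parE->]; rewrite ?par1.
have kids_core i : i != i0 -> i != j -> kids (inl i) = 0.
  move=> ii ij; rewrite /kids big_pred0 // => n'; apply/negbTE.
  case: (eqVneq n' n1) => [->|/parE->]; rewrite ?par1 (inj_eq inl_inj) eq_sym //.
have kids_j : kids (inl j) = r * x (inl j) + x (inr n1).
  rewrite /kids (big_pred1 n1) // => n /=.
  case: (eqVneq n n1) => [->|/parE->]; first by rewrite par1 eqxx.
  by rewrite (inj_eq inl_inj) eq_sym (negbTE ji).
have xn1 : w * x (inr n1) = x (inl j) by rewrite tree_eq kids_tree addr0 par1.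
have xq : w * x (inr q) = 1 by rewrite tree_eq kids_tree addr0 par_q.
have [v vu vmax] : exists2 v, v != u & forall v', v' != u -> x v' <= x v.
  have jlu : inl j != u by rewrite (inj_eq inl_inj).
  have := @arg_maxP _ _ _ (inl j : 'I_l + N) (fun v => v != u) x jlu.
  by case=> v vu vmax; exists v.
have b0 : 0 < x v := x_gt0 v.
have ej := core_eq j; rewrite kids_j in ej.
have xjS : x (inl (ordS j)) <= x v.
  apply: vmax; apply: contraNneq jP => -[Sj].
  by rewrite -(inj_eq (@ordS_inj l)) ord_predK Sj.
have xjP : x (inl (ord_pred j)) <= x v.
  apply: vmax; apply: contraNneq jS => -[Pj].
  by rewrite -Pj ord_predK.
have hb : (w - 1 - r) * x v <= 1.
  case: v vu vmax b0 xjS xjP => [i|n] vu vmax b0 xjS xjP; last first.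
    have := tree_eq n; rewrite kids_tree addr0.
    have rb : 0 <= r * x (inr n) by rewrite mulr_ge0 // ltW.
    by have := x_le1 (par n); lra.
  have iu : i != i0 by rewrite -(inj_eq (@inl_inj _ N)).
  case: (eqVneq i j) => [ij|ij]; last first.
    have := core_eq i; rewrite kids_core // addr0.
    case: (eqVneq (ordS i) i0) => [Si|Si].
      have pi : inl (ord_pred i) != u.
        by apply/eqP => -[pi]; have := ordS_ord_pred_neq i l_gt2; rewrite Si pi eqxx.
      by have := vmax _ pi; have := x_le1 (inl (ordS i)); lra.
    have si : inl (ordS i) != u by rewrite (inj_eq inl_inj).
    by have := vmax _ si; have := x_le1 (inl (ord_pred i)); lra.
  (* The second largest vertex cannot be j itself: without u among its neighbours, its equation
     would give (w^2 - 2 r w - 2 w - 1) x_j <= 0. *)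
  rewrite ij in b0 xjS xjP *.
  have := ler_wpM2l (ltW w_gt0) xjS; have := ler_wpM2l (ltW w_gt0) xjP.
  have ejw : w * (w * x (inl j)) = w * (r * x (inl j) + x (inl (ordS j)) +
    x (inl (ord_pred j)) + (r * x (inl j) + x (inr n1))) by rewrite -ej.
  have : 0 < (w ^+ 2 - 2 * r * w - 2 * w - 1) * x (inl j).
    rewrite mulr_gt0 //.
    have : 0 <= w * (w - (21 / 5 + 27 / 20 * r)).
      by rewrite mulr_ge0 ?(ltW w_gt0) //; move: wl r_le1; lra.
    have : 0 <= (1 - r) * w by rewrite mulr_ge0 ?(ltW w_gt0) //; move: wl r_le1; lra.
    move: r_ge0; lra.
  move: ej xn1 ejw; lra.
rewrite -(ltr_pM2l w_gt0) xq.
apply: (numeric_far_vertex w_gt0 r_ge0 r_le1 w_quad b0 hb).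
have := ler_wpM2l (ltW w_gt0) xjS; have := ler_wpM2l (ltW w_gt0) xjP.
have ejw : w * (w * x (inl j)) = w * (r * x (inl j) + x (inl (ordS j)) +
    x (inl (ord_pred j)) + (r * x (inl j) + x (inr n1))) by rewrite -ej.
lra.
Qed.

End FarVertex.
End PerronEstimates.

(** * Elimination of the vertices of degree one *)

Section PerronReduction.
Variables (F : realFieldType) (m : nat) (V E : finType) (ends : E -> {set V}).
Variables (H : hypergraph) (io : V -> H) (ph : E -> {set H}).
Hypotheses (m2 : (2 <= m)%N) (sk : skeleton m ends io ph).
Hypotheses (ends2 : forall e, #|ends e| = 2%N) (ph_inj : injective ph).
Hypothesis linH : linear_hypergraph H.
Variables (x : H -> F) (mu : F).
Hypotheses (x_gt0 : forall y, 0 < x y) (mu_ge0 : 0 <= mu).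
Hypothesis xE : forall y, \sum_(y' | adjacent y y') x y' = mu * x y.

Let n : F := (m - 1)%:R.
Let w := mu - n + 1.
Let r := (n - 1) / (w + n).

Let wn_gt0 : 0 < w + n.
Proof. by rewrite /w; move: mu_ge0; lra. Qed.

Lemma eigen_edges y : mu * x y = \sum_(e | y \in ph e) (\sum_(y' in ph e) x y' - x y).
Proof.
rewrite -xE sum_adjacent // (sk_edges sk) big_mkcondr /= big_imset /=; last first.
  by move=> e e' _ _; apply: ph_inj.
by rewrite -big_mkcond.
Qed.

(** Each of the n - 1 private vertices of e has weight 1 / (w + n) times the sum over e, because mu
    + 1 = w + n. *)
Lemma eigen_edge_sum e :
  (w + 1) * \sum_(y in ph e) x y = (w + n) * \sum_(v in ends e) x (io v).
Proof.
have own y : y \in own_vertices io ph e -> (w + n) * x y = \sum_(y' in ph e) x y'.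
  rewrite inE => /andP[ye yio]; have := eigen_edges y.
  rewrite (big_pred1 e) => [|e' /=]; last first.
    apply/idP/eqP => [ye'|->] //.
    by apply/eqP; apply: contraNT yio; apply: (sk_disj sk ye' ye).
  rewrite /w; lra.
have split_e : \sum_(y in ph e) x y =
    \sum_(v in ends e) x (io v) + \sum_(y in own_vertices io ph e) x y.
  rewrite (bigID (fun y => y \in codom io)) /=; congr (_ + _); last first.
    by apply: eq_bigl => y; rewrite inE.
  rewrite -(big_imset x (in2W (sk_inj sk))) /=; apply: eq_bigl => y.
  apply/andP/imsetP => [[ye /codomP[v yE]]|[v ve ->]].
    by exists v; rewrite // -(sk_ends sk) -yE.
  by rewrite (sk_ends sk) ve codom_f.
have own_sum : (w + n) * \sum_(y in own_vertices io ph e) x y =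
    (n - 1) * \sum_(y in ph e) x y.
  rewrite mulr_sumr (eq_bigr _ own) sumr_const (card_own_vertices e sk) ends2.
  have -> : n - 1 = (m - 2)%:R.
    by rewrite /n -[X in _ - X]/(1%:R) -natrB ?subn_gt0 // -subnDA.
  by rewrite mulr_natl.
have := split_e; move: own_sum; set s := \sum_(y in ph e) x y.
move=> own_sum sE; have : (w + n) * s = (w + n) * \sum_(v in ends e) x (io v) + (n - 1) * s.
  by rewrite {1}sE mulrDr own_sum.
lra.
Qed.

Lemma weight_r : (0 < #|E|)%N -> 0 <= r /\ r <= 1.
Proof.
move=> /card_gt0P[e _].
have n1 : 1 <= n by rewrite /n (ler_nat F 1) subn_gt0.
have rge0 : 0 <= r by rewrite divr_ge0 ?subr_ge0 // ltW.
have w1 : 0 < w + 1.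
  have pos_sum (T : finType) (A : {set T}) (g : T -> F) :
      (0 < #|A|)%N -> (forall y, 0 < g y) -> 0 < \sum_(y in A) g y.
    move=> /card_gt0P[a aA] g0; rewrite (bigD1 a) //= ltr_pwDl // sumr_ge0 // => y _.
    exact: ltW.
  have s0 : 0 < \sum_(y in ph e) x y.
    by apply: pos_sum => //; rewrite (sk_card sk) ltnW.
  rewrite -(pmulr_lgt0 _ s0) eigen_edge_sum mulr_gt0 //.
  by apply: pos_sum => //; rewrite ends2.
split=> //.
rewrite /r ler_pdivrMr // mul1r; lra.
Qed.

(** Multiply by w + n and use (w + n) (w + r) = (w + 1) mu and (w + n) (1 - r) = w + 1. The edge
    term is the weight of the other end plus r x_v, written without naming that end. *)
Lemma perron_graph_eq v : (w + r) * x (io v) =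
  \sum_(e | v \in ends e) (\sum_(v' in ends e) x (io v') - (1 - r) * x (io v)).
Proof.
have wn0 : w + n != 0 by rewrite gt_eqF.
apply: (mulfI wn0); rewrite mulr_sumr.
have -> : (w + n) * ((w + r) * x (io v)) = (w + 1) * (mu * x (io v)).
  rewrite /r; have -> : mu = w + n - 1 by rewrite /w; ring.
  by field.
rewrite eigen_edges mulr_sumr (eq_bigl (fun e => v \in ends e)); last first.
  by move=> e; rewrite (sk_ends sk).
apply: eq_bigr => e _; rewrite !mulrBr eigen_edge_sum; congr (_ - _).
by rewrite /r; field.
Qed.

End PerronReduction.

Section TreeEigenEquations.
Variables (F : realFieldType) (l : nat) (N : finType) (par : N -> 'I_l + N).
Variables (rk : N -> nat) (x : 'I_l + N -> F) (w r : F).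
Hypothesis l_gt2 : (2 < l)%N.
Hypothesis rkP : forall n n', par n = inr n' -> (rk n' < rk n)%N.
Hypothesis graph_eq : forall v, (w + r) * x v =
  \sum_(e | v \in tree_ends par e) (\sum_(v' in tree_ends par e) x v' - (1 - r) * x v).

Lemma sum_set2 a b : a != b -> \sum_(v in [set a; b]) x v = x a + x b.
Proof. by move=> ab; rewrite big_setU1 ?inE // big_set1. Qed.

Lemma tree_ends_core_eq i : w * x (inl i) =
  r * x (inl i) + x (inl (ordS i)) + x (inl (ord_pred i)) + kids par x r (inl i).
Proof.
have := graph_eq (inl i); rewrite big_sumType /=.
have Si (j : 'I_l) : ordS j != j := ordS_neq j (ltnW l_gt2).
have Pi (j : 'I_l) : ord_pred j != j := ord_pred_neq j (ltnW l_gt2).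
rewrite (bigD1 i) ?set21 //= (bigD1 (ord_pred i)) /=; last first.
  by rewrite ord_predK set22 /= Pi.
rewrite [X in _ + (_ + X) + _]big1 => [|j]; last first.
  rewrite !inE !(inj_eq (@inl_inj _ _)) -!andbA => /and3P[/orP[/eqP->|/eqP->]].
    by rewrite eqxx.
  by rewrite ordSK eqxx.
rewrite ord_predK !sum_set2; [|by rewrite (inj_eq (@inl_inj _ _)) 1?[_ == ordS _]eq_sym..].
have -> : \sum_(n | inl i \in [set inr n; par n])
    (\sum_(v' in [set inr n; par n]) x v' - (1 - r) * x (inl i)) = kids par x r (inl i).
  rewrite /kids (eq_bigl (fun n => par n == inl i)) => [|n]; last first.
    by rewrite !inE eq_sym.
  apply: eq_bigr => n /eqP pn; rewrite pn sum_set2 //; ring.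
move=> eq; lra.
Qed.

Lemma tree_ends_tree_eq n : w * x (inr n) = x (par n) + kids par x r (inr n).
Proof.
have := graph_eq (inr n); rewrite big_sumType /= big_pred0 ?add0r => [|j]; last first.
  by rewrite !inE.
rewrite (bigD1 n) ?set21 //= sum_set2; last by rewrite eq_sym (parN rkP).
have -> : \sum_(i | (inr n \in [set inr i; par i]) && (i != n))
    (\sum_(v' in [set inr i; par i]) x v' - (1 - r) * x (inr n)) = kids par x r (inr n).
  rewrite /kids (eq_bigl (fun n' => par n' == inr n)) => [|n']; last first.
    rewrite !inE (inj_eq (@inr_inj _ _)) eq_sym [inr n == _]eq_sym.
    case: (eqVneq n' n) => [->|_] /=; last by rewrite andbT.
    by rewrite (negbTE (parN rkP n)).
  apply: eq_bigr => n' /eqP pn; rewrite pn sum_set2; first by ring.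
  by rewrite -pn eq_sym (parN rkP).
move=> eq; lra.
Qed.

End TreeEigenEquations.

(** * Comparison *)

Section StarQuadratic.
Variables (F : realFieldType) (w n c : F).
Hypotheses (w_gt0 : 0 < w) (n_ge1 : 1 <= n).
Hypothesis star : (c + 1) * n <= (w + n - 1) * w.
Let r := (n - 1) / (w + n).

Let wn_gt0 : 0 < w + n.
Proof. by rewrite addr_gt0 // (lt_le_trans ltr01). Qed.

Lemma star_quadratic_star : r * c * w + c + 1 <= w ^+ 2.
Proof.
have h : 0 <= (w + 1) * ((w + n - 1) * w - (c + 1) * n).
  by rewrite mulr_ge0 ?subr_ge0 // addr_ge0 // ltW.
rewrite -subr_ge0 -(pmulr_lge0 _ wn_gt0).
suff -> : (w ^+ 2 - (r * c * w + c + 1)) * (w + n) =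
  (w + 1) * ((w + n - 1) * w - (c + 1) * n) by [].
by rewrite /r; field; rewrite gt_eqF.
Qed.

(** The constants come from c >= 5 + 12 / n and the identity 1 + r w = n (1 - r): the lower bound (1
    + r w) c + 1 for w^2 is at least 5 (1 + r w) + 12 (1 - r) + 1. *)
Lemma star_quadratic_quad : 12 <= (c - 5) * n -> 18 - 12 * r + 5 * r * w <= w ^+ 2.
Proof.
move=> hc; have h : 0 <= (w + 1) * ((w + n - 1) * w - 6 * n - 12).
  by apply: mulr_ge0; [apply: addr_ge0 => //; apply: ltW|move: star hc; lra].
rewrite -subr_ge0 -(pmulr_lge0 _ wn_gt0).
suff -> : (w ^+ 2 - (18 - 12 * r + 5 * r * w)) * (w + n) =
  (w + 1) * ((w + n - 1) * w - 6 * n - 12) by [].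
by rewrite /r; field; rewrite gt_eqF.
Qed.

End StarQuadratic.

Lemma ULC_degree m l c (p : UC_pendant l [:: c]) (t : 'I_(m - 1)) (i0 : 'I_l) :
    (2 <= m)%N -> (2 < l)%N -> i0 = 0%N :> nat ->
  #|[set e in hedges (ULC p t) | inl (inl (inl i0)) \in e]| = (2 + c)%N.
Proof.
move=> m2 l3 i00.
rewrite (attach_degree (fun _ : unit => inr (p, t) : UC m l [:: c])) // UC_degree //.
rewrite [X in (_ + X)%N](_ : _ = 0%N) ?addn0; last first.
  by apply: eq_card0 => u; rewrite !inE.
congr (_ + _)%N; rewrite -[RHS](@card_UC_pendant1 l c) ?(ltn_trans _ l3) //.
rewrite -cardsT; congr #|pred_of_set _|; apply/setP => q; rewrite !inE.
by apply/eqP/ord_inj; rewrite tag_UC_pendant1.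
Qed.

Section Dichotomy.
Variables (F : realFieldType) (m l k : nat) (H : hypergraph).
Hypotheses (m2 : (2 <= m)%N) (H_power : is_power m H) (conH : connected_hypergraph H).
Hypotheses (linH : linear_hypergraph H) (uniH : unicyclic H) (kH : #|hedges H| = k).
Hypothesis cycH : exists S : {set {set H}}, cycle_of_length l S.
Hypothesis kl : (12 <= (k - l - 5) * (m - 1))%N.
Hypothesis ne1 : ~ hiso H (UC m l [:: (k - l)%N]).
Hypothesis ne2 : ~ hiso H (UC m l [:: (k - l - 1)%N; 1%N]).
Variables (p : UC_pendant l [:: (k - l - 1)%N]) (t : 'I_(m - 1)).

(** The strict alternative is what yields the equality case of the theorem. *)
Lemma top_eigenvalue_dichotomy (mu mu' : F) :
    top_eigenvalue H mu -> top_eigenvalue (ULC p t) mu' ->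
  mu < mu' \/ hiso H (ULC p t).
Proof.
move=> topH topK.
have [l3 [N [par [rk [io [ph [rkP sk]]]]]]] := unicyclic_skeleton m2 H_power conH uniH cycH.
have ends2 := tree_ends2 l3 rkP.
have ends_inj := tree_ends_inj l3 rkP.
have ph_inj := skeleton_ph_inj sk ends_inj.
have cN : #|N| = (k - l)%N.
  rewrite -kH (sk_edges sk) card_imset // card_sum card_ord.
  by rewrite addnC addnK.
(* The subtraction is truncated, but a zero factor would contradict [kl]. *)
have c6 : (5 < #|N|)%N.
  by rewrite cN -subn_gt0; case: (k - l - 5)%N kl.
have cS : (k - l - 1).+1 = #|N| by rewrite cN subn1 prednK // -cN (ltn_trans _ c6).
have c1 : (0 < #|N|.-1)%N by rewrite -subn1 subn_gt0 (ltn_trans _ c6).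
have [x0 x0_gt0 x0E] := top_eigenvalue_pos topH conH.
have mu0 := top_eigenvalue_ge0 topH.
have l0 : (0 < l)%N by apply: ltn_trans l3.
pose o := Ordinal l0.
(* Only skeleton vertices compete for the maximum, since the reduced equations involve no others. *)
have [u _ umax] := @arg_maxP _ _ _ (inl o : 'I_l + N) xpredT (x0 \o io) isT.
pose x y := x0 y / x0 (io u).
have x_gt0 y : 0 < x y by rewrite divr_gt0.
have xE y : \sum_(y' | adjacent y y') x y' = mu * x y.
  by rewrite -mulr_suml x0E mulrA.
have xu : x (io u) = 1 by rewrite /x divff // gt_eqF.
have x_le1 v : x (io v) <= 1.
  by rewrite ler_pdivrMr // mul1r; apply: umax.
pose n : F := (m - 1)%:R; pose w := mu - n + 1; pose r := (n - 1) / (w + n).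
have n1 : 1 <= n by rewrite (ler_nat F 1) subn_gt0.
have E0 : (0 < #|{: 'I_l + N}|)%N by rewrite card_sum card_ord ltn_addr.
have [r0 r1] := weight_r m2 sk ends2 ph_inj linH x_gt0 mu0 xE E0.
rewrite -/n -/w -/r in r0 r1.
pose X v := x (io v).
have graph_eq v : (w + r) * X v = \sum_(e | v \in tree_ends par e)
    (\sum_(v' in tree_ends par e) X v' - (1 - r) * X v).
  exact: (perron_graph_eq m2 sk ends2 ph_inj linH mu0 xE v).
have core_eq := tree_ends_core_eq l3 graph_eq.
have tree_eq := tree_ends_tree_eq rkP graph_eq.
have X_gt0 v : 0 < X v by apply: x_gt0.
have w0 : 0 < w.
  have /card_gt0P[n' _] : (0 < #|N|)%N by apply: leq_ltn_trans c6.
  rewrite -(pmulr_lgt0 _ (X_gt0 (inr n'))) tree_eq ltr_pwDl // sumr_ge0 // => n'' _.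
  by apply: addr_ge0; [apply: mulr_ge0 => //|]; apply: ltW.
have muE : mu = w + n - 1 by rewrite /w; ring.
(* If the star with c + 1 edges beats mu the comparison is over; otherwise w is large enough for the
   estimates at u. *)
case: (ltP ((w + n - 1) * w) ((#|N|%:R + 1) * n)) => [small|big].
  left; rewrite muE.
  have linK : linear_hypergraph (ULC p t) by apply: attach_linear; apply: UC_linear.
  have unifK : uniform m (ULC p t).
    by apply: attach_uniform; [apply: ltnW|apply: UC_uniform; rewrite // ltnW].
  apply: (@star_bound F m (ULC p t) mu' w (inl (inl (inl o))) linK unifK topK w0).
  rewrite (ULC_degree p t (i0 := o)) // (_ : (2 + _)%N = #|N|.+1); last by rewrite -cS.
  by rewrite -natr1.
have w_star := star_quadratic_star w0 n1 big.
have w_quad : 18 - 12 * r + 5 * r * w <= w ^+ 2.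
  apply: (star_quadratic_quad w0 n1 big).
  have -> : (#|N|%:R - 5) * n = ((k - l - 5) * (m - 1))%:R.
    by rewrite natrM natrB ?cN // -cN ltnW.
  by rewrite (ler_nat F 12).
have [v xv] : exists v, X v = 1 by exists u.
case: v xv => [i0|n'] xv; last first.
  by case: (tree_maximum_false l3 rkP w0 r0 r1 core_eq tree_eq w_quad w_star xv x_le1).
have count_lt :=
  core_maximum_count l3 rkP w0 r0 r1 X_gt0 core_eq tree_eq w_quad w_star xv x_le1.
have card_le : (#|[set n' | par n' != inl i0]| <= 1)%N.
  move: count_lt; rewrite /rcount (eq_bigl (mem [set n' | par n' != inl i0])).
    by rewrite sumr_const (ltr_nat F _ 2).
  by move=> n'; rewrite /= inE.
have [s [s_auto s_i0 s_Si0]] := cycle_rotation i0 (ltnW l3).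
case: (posnP #|[set n' | par n' != inl i0]|) => [/eqP|n1_gt0].
  rewrite cards_eq0 => /eqP no; case: ne1.
  have par_i0 n' : par n' = inl i0.
    by apply/eqP; have /setP/(_ n') := no; rewrite !inE => /negbFE.
  have /prescribed_bijection : #|N| = #|{: UC_pendant l [:: (k - l)%N]}|.
    by rewrite card_UC_pendant1.
  have /card_gt1P[a [b [_ _ ab]]] : (1 < #|N|)%N by apply: ltn_trans c6.
  have /card_gt1P[a' [b' [_ _ ab']]] : (1 < #|{: UC_pendant l [:: (k - l)%N]}|)%N.
    by rewrite card_UC_pendant1 // -cN; apply: ltn_trans c6.
  move=> /(_ _ _ _ _ ab ab')[h [h_bij _ _]].
  apply: (UC_hiso t m2 l3 sk s_auto (f := fun=> i0) (h := h)) => // n'.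
  by apply: ord_inj; rewrite tag_UC_pendant1.
have /cards1P[n2 n2E] : #|[set n' | par n' != inl i0]| == 1%N.
  by rewrite eqn_leq card_le.
have par_n2 : par n2 != inl i0 by have := set11 n2; rewrite -n2E inE.
have par_i0 n' : n' != n2 -> par n' = inl i0.
  move=> ne; apply/eqP; apply: contraNT ne => pn.
  by have : n' \in [set n2] by [rewrite -n2E inE]; rewrite inE.
(* Used with a rotation and with a reflection, this excludes both cycle neighbours of u as the place
   of the stray edge. The only pendant edge at core vertex 1 is [q1], so it has to be the image of
   [n2]. *)
have UC2 j s' sE' : cycle_auto s' sE' -> s' i0 = 0%N :> nat -> s' j = 1%N :> nat ->
    par n2 = inl j -> False.
  move=> s'_auto s'i0 s'j parn2; apply: ne2.
  have l1 : (1 < l)%N by apply: ltnW.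
  pose q1 : UC_pendant l [:: (k - l - 1)%N; 1%N] :=
    Tagged (fun i : 'I_l => 'I_(nth 0%N [:: (k - l - 1)%N; 1%N] i)) (i := Ordinal l1) ord0.
  have cP : #|N| = #|{: UC_pendant l [:: (k - l - 1)%N; 1%N]}|.
    by rewrite card_UC_pendant2 ?cS.
  have /card_gt0P[q2] : (0 < #|[set~ q1]|)%N.
    by rewrite cardsC1 -cP.
  rewrite !inE eq_sym => q12.
  have /card_gt0P[n3] : (0 < #|[set~ n2]|)%N.
    by rewrite cardsC1.
  rewrite !inE eq_sym => n23.
  have [h [h_bij hn2 _]] := prescribed_bijection cP n23 q12.
  apply: (UC_hiso t m2 l3 sk s'_auto
    (f := fun n' => if n' == n2 then j else i0) (h := h)) => // n'.
    by case: eqVneq => [->//|/par_i0].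
  case: eqVneq => [->|ne]; first by apply: ord_inj; rewrite hn2 s'j.
  apply: ord_inj; rewrite s'i0.
  have : h n' != q1 by rewrite -hn2 (inj_eq (bij_inj h_bij)).
  case: (h n') => -[[|[|i]] il] [q qlt] //=; last by move: qlt; rewrite /= nth_nil.
  case/eqP; move: il qlt => il; rewrite (bool_irrelevance il l1) => qlt.
  by apply: (congr1 (Tagged _)); apply: val_inj; case: q qlt.
have cP : #|N| = #|{: UC_pendant l [:: (k - l - 1)%N] + unit}|.
  by rewrite card_sum card_UC_pendant1 // card_unit addn1 cS.
case par2: (par n2) => [j|n3].
  left.
  have ji : j != i0 by apply: contraNneq par_n2 => <-; rewrite par2.
  have jS : j != ordS i0.
    by apply/eqP => jE; apply: (UC2 _ _ _ s_auto s_i0 s_Si0); rewrite par2 jE.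
  have jP : j != ord_pred i0.
    have [s' [sE' [s'_auto s'i0 s'P]]] := cycle_reflection i0 (ltnW l3).
    by apply/eqP => jE; apply: (UC2 _ _ _ s'_auto s'i0 s'P); rewrite par2 jE.
  have /card_gt0P[n3] : (0 < #|[set~ n2]|)%N.
    by rewrite cardsC1.
  rewrite !inE eq_sym => n23.
  (* The leaf [n3] at u is sent to the pendant edge p, whose vertex numbered t is where [ULC]
     attaches the extra edge. Moving the stray edge from j to [n3] therefore produces [ULC p t]
     itself. *)
  have [h [h_bij hn2 hn3]] := prescribed_bijection cP n23 (isT : inr tt != inl p).
  have [f [f_bij f_edges] f_io] := attached_UC_iso t m2 l3 sk s_auto h_bij hn2 par_i0 s_i0
    (va := inl (s j)) (congr1 (extra_vertex h s) par2).
  have adjE := adjacent_iso f_bij f_edges.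
  have [g fK gK] := f_bij.
  have far := far_vertex_small l3 w0 r0 r1 X_gt0 core_eq tree_eq w_quad xv x_le1
    par2 par_i0 ji jS jP (par_i0 _ _ : par n3 = inl i0).
  have linU : linear_hypergraph (UC m l [:: (k - l - 1)%N]) by apply: UC_linear.
  apply: (attach_move (x := x \o g) m2 linU _ _ topK).
  - by move=> y; apply: x_gt0.
  - move=> y; rewrite (reindex f) /=; last exact: onW_bij.
    rewrite -xE -{1}(gK y); apply: eq_big => [y'|y' _]; first exact: adjE.
    by rewrite fK.
  - have := f_io (inl j); have := f_io (inr n3); rewrite /= hn3 /= => e1 e2.
    rewrite -[inl (inr (p, t))]e1 -[inl (inl (inl (s j)))]e2 /= !fK.
    by apply: far; rewrite eq_sym.
right.
have n32 : n3 != n2.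
  by apply/eqP => nE; have := rkP _ _ par2; rewrite nE ltnn.
have n23 : n2 != n3 by rewrite eq_sym.
have [h [h_bij hn2 hn3]] := prescribed_bijection cP n23 (isT : inr tt != inl p).
have va_eq : extra_vertex h s (par n2) = inl (inr p) by rewrite par2 /= hn3.
have [f [f_bij f_edges] _] := attached_UC_iso t m2 l3 sk s_auto h_bij hn2 par_i0 s_i0 va_eq.
by exists f.
Qed.

End Dichotomy.

Theorem theorem3p3p1 (C : numClosedFieldType) (m k l : nat) (H : hypergraph)
    (hm : (2 <= m)%N)
    (hpower : is_power m H)
    (hunif : uniform m H)
    (hconn : connected_hypergraph H)
    (hlin : linear_hypergraph H)
    (hunic : unicyclic H)
    (hk : #|hedges H| = k)
    (hl : exists S : {set {set H}}, cycle_of_length l S)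
    (hkl : (12 <= (k - l - 5) * (m - 1))%N)
    (hne1 : ~ hiso H (UC m l [:: (k - l)%N]))
    (hne2 : ~ hiso H (UC m l [:: (k - l - 1)%N; 1%N]))
    (p : UC_pendant l [:: (k - l - 1)%N]) (t : 'I_(m - 1)) :
  lambda1 C m H <= lambda1 C m (ULC p t) /\
  (lambda1 C m H = lambda1 C m (ULC p t) -> hiso H (ULC p t)).
Proof.
have n_gt0 : 0 < (m - 1)%:R :> C by rewrite ltr0n subn_gt0.
have H_gt0 : (0 < #|H|)%N.
  have [S [v [e [[l3 _ _ _ _] _]]]] := hl.
  by apply/card_gt0P; exists (v (Ordinal (ltn_trans (isT : 0 < 2)%N l3))).
have K_gt0 : (0 < #|ULC p t|)%N by apply/card_gt0P; exists (inr (tt, t)).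
have [mu muE topH] := lambda1_top_eigenvalue C hm H_gt0.
have [mu' mu'E topK] := lambda1_top_eigenvalue C hm K_gt0.
rewrite -(ler_pM2l n_gt0) -muE -mu'E.
have eqE : lambda1 C m H = lambda1 C m (ULC p t) -> mu = mu'.
  by move=> lE; apply: val_inj; rewrite /= muE mu'E lE.
have [lt|iso] := top_eigenvalue_dichotomy hm hpower hconn hlin hunic hk hl hkl
  hne1 hne2 topH topK.
  split; first exact: ltW lt.
  by move=> /eqE mu_eq; rewrite mu_eq ltxx in lt.
by split; first exact: (top_eigenvalue_hiso topH iso topK).
Qed.
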